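(* Let $c=2^{16}$. Let $G=(V,E)$ be a finite unweighted graph, let $X\subseteq V$ be such that the induced subgraph $G[X]$ is connected, let $x_0\in X$, and let $Q=(z_1,\dots,z_{|X|-1})$ be any ordering of $X\setminus\{x_0\}$. Let $T$ be any spanning tree of $G[X]$ that can be returned by the (randomized) algorithm hierarchical-star-partition$(X,x_0,Q)$ with constant $c$ and with parameter function $\epsilon(Z)=\frac{1}{170c\,\log\log(|Z|)}$. Then for every $1\le i\le |X|-1$, $$d_T(x_0,z_i)\le\begin{cases} d_X(x_0,z_i) & i=1,\\ i\cdot \mathrm{rad}_{x_0}(X) & 1<i<c,\\ c\cdot\log\log i\cdot \mathrm{rad}_{x_0}(X) & i\ge c.\end{cases}$$
   Context: Graphs are undirected and all edges have length $1$; logarithms are to base $2$. For $Z\subseteq V$, $d_Z$ is the shortest path metric of the induced subgraph $G[Z]$ (with value $\infty$ between different components), and $\mathrm{rad}_x(Z)=\max_{y\in Z}d_Z(x,y)$ for $x\in Z$. For a (pseudo-)metric $\delta$ on $Z$, $B_{(Z,\delta)}(x,r)=\{y\in Z:\delta(x,y)\le r\}$. $d_T$ is the shortest path metric of the tree $T$. Cone metric: for $Y\subset X\subseteq V$, $x\in X\setminus Y$, $y\in Y$, let $\rho(X,Y,x,y)$ be the pseudo-metric on $Y$ given by $\rho(u,v)=|(d_X(x,u)-d_Y(y,u))-(d_X(x,v)-d_Y(y,v))|$. The ball $B_{(Y,\rho)}(y,r)$ is the set of $z\in Y$ with $d_X(x,y)+d_Y(y,z)-d_X(x,z)\le r$.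 Algorithm hierarchical-star-partition$(X,x_0,Q)$ ($G[X]$ connected, $x_0\in X$, $Q$ an ordering of $X\setminus\{x_0\}$), depending on a number $c$ and a function $\epsilon(\cdot)$ of the cluster: if $\mathrm{rad}_{x_0}(X)\le 16c$, return a breadth first search (shortest path) tree of $G[X]$ rooted at $x_0$. Otherwise run star-partition$(X,x_0,Q)$ to obtain clusters $X_0,\dots,X_m$ partitioning $X$, edges $(y_1,x_1),\dots,(y_m,x_m)$ of $G$ with $y_j\in X_0$, $x_j\in X_j$, and orderings $Q_j$ of $X_j\setminus\{x_j\}$ for $0\le j\le m$; recursively compute $T_j=$ hierarchical-star-partition$(X_j,x_j,Q_j)$ for all $j$; return the tree formed by $T_0,\dots,T_m$ together with the edges $(y_j,x_j)$, $1\le j\le m$. Algorithm star-partition$(X,x_0,Q)$, with $Q=(z_1,\dots,z_k)$, $\Delta=\mathrm{rad}_{x_0}(X)$, $\epsilon=\epsilon(X)\in(0,\frac1{170c}]$: (1) Central ball: choose $r_0$ uniformly at random from $[\frac1{16c},\frac1{8c}]$; $X_0=B_{(X,d_X)}(x_0,r_0\Delta)$, $Y_0=X\setminus X_0$. (2) First cone: if $z_1\in Y_0$ let $z=z_1$, otherwise let $z\in Y_0$ be arbitrary. Let $(y_1,x_1)$ be an edge with $y_1\in X_0$, $x_1\in Y_0$ and $d_X(x_0,z)=d_X(x_0,y_1)+d_X(y_1,x_1)+d_{Y_0}(x_1,z)$. Choose $r_1$ uniformly from $[\epsilon/4,\epsilon/2]$; with $\rho=\rho(X,Y_0,x_0,x_1)$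 let $X_1=B_{(Y_0,\rho)}(x_1,r_1\Delta)$, $Y_1=Y_0\setminus X_1$. (3) Remaining cones: for $j=2,3,\dots$ while $Y_{j-1}\ne\emptyset$: let $(x_j,y_j,r_j)=$ cone-cut$(X,x_0,X_0,Y_{j-1},\epsilon)$; with $\rho=\rho(Y_{j-1}\cup X_0,Y_{j-1},x_0,x_j)$ let $X_j=B_{(Y_{j-1},\rho)}(x_j,r_j\Delta)$, $Y_j=Y_{j-1}\setminus X_j$. (4) Queues: initially all are empty. For $i=1,\dots,|X|-1$: if $z_i\in X_0$, append $z_i$ to $Q_0^{(\mathrm{ball})}$. Otherwise let $\ell\ge1$ with $z_i\in X_\ell$; if $z_i\neq x_\ell$ append $z_i$ to $Q_\ell$; if $y_\ell\notin Q_0^{(\mathrm{reg})}$ append $y_\ell$ to $Q_0^{(\mathrm{reg})}$; if $|X_\ell\cap\{z_1,\dots,z_i\}|>\sqrt i$ and $y_\ell\notin Q_0^{(\mathrm{fat})}$ append $y_\ell$ to $Q_0^{(\mathrm{fat})}$. (5) $Q_0$ is an ordering of $X_0\setminus\{x_0\}$ (each element listed once) obtained by interleaving $Q_0^{(\mathrm{ball})},Q_0^{(\mathrm{fat})},Q_0^{(\mathrm{reg})}$ so that: its first element is $z_1$ if $z_1\in X_0$ and $y_1$ otherwise; and any element which is $i$-th in one of the three queues is among the first $3i$ elements of $Q_0$. Algorithm cone-cut$(X,x_0,X_0,Y,\epsilon)$: let $p\in Y$ minimize $|X|/|B_{(Y,d_Y)}(z,\epsilon\,\mathrm{rad}_{x_0}(X)/16)|$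 over $z\in Y$ and let $\chi$ be the minimum. Let $(y,x)$ be an edge with $x\in Y$, $y\in X_0$ and $d_X(x_0,y)+d_X(y,x)+d_Y(x,p)=d_X(x_0,p)$. Divide $[\epsilon/4,\epsilon/2]$ into $N=\lceil 2\log\chi\rceil$ consecutive intervals $S_1,\dots,S_N$ of equal length; start with $h=1$; repeatedly toss a fair coin, and as long as it is heads and $h<N$ increase $h$ by $1$; then choose $r$ uniformly from $S_h$. Return $(x,y,r)$. All random choices are independent. *)

(* Defs.v *)
(* MathComp / MathComp-Analysis. *)
From HB Require Import structures.
From mathcomp Require Import all_boot all_order all_algebra.
From mathcomp Require Import all_classical all_reals all_analysis.

Set Implicit Arguments.
Unset Strict Implicit.
Unset Printing Implicit Defensive.

Import Order.TTheory GRing.Theory Num.Theory.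
Local Open Scope ring_scope.

Definition log2 {R : realType} (x : R) : R := ln x / ln 2.

(** ** Graphs *)

(* [x :: p] is a walk, with [size p] edges, from [x] to [y] inside [Z]. *)
Definition walk (V : finType) (e : rel V) (Z : {set V}) (x y : V) (p : seq V) :
    bool :=
  [&& path e x p, last x p == y & all [in Z] (x :: p)].

Definition graph_connected (V : finType) (e : rel V) (Z : {set V}) : Prop :=
  {in Z &, forall x y, exists p, walk e Z x y p}.

(* [ereal_inf] of the empty set is [+oo], so vertices in different components
   of the induced subgraph are at distance [+oo]. *)
Definition dist {R : realType} {V : finType} (e : rel V) (Z : {set V})
    (x y : V) : \bar R :=
  ereal_inf [set ((size p)%:R : R)%:E | p in [set p | walk e Z x y p]]%classic.

Definition graph_rad {R : realType} {V : finType} (e : rel V) (x : V)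
    (Z : {set V}) : \bar R :=
  (\big[maxe/-oo]_(y in Z) dist e Z x y)%E.

Definition metric_ball {R : realType} {V : finType} (Z : {set V})
    (delta : V -> V -> \bar R) (x : V) (r : \bar R) : {set V} :=
  [set y in Z | (delta x y <= r)%E].

Definition cone_metric {R : realType} {V : finType} (e : rel V)
    (X Y : {set V}) (x y : V) : V -> V -> \bar R :=
  fun u v => `|(dist e X x u - dist e Y y u)
             - (dist e X x v - dist e Y y v)|%E.

(** ** Trees, given by their sets of undirected edges [[set u; v]] *)

Definition adj (V : finType) (T : {set {set V}}) : rel V :=
  fun u v => [set u; v] \in T.

Definition spanning_tree (V : finType) (e : rel V) (X : {set V})
    (T : {set {set V}}) : Prop :=
  [/\ forall E, E \in T ->
        exists u v, [/\ u \in X, v \in X, e u v & E = [set u; v]],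
      graph_connected (adj T) X
    & forall p, ucycle (adj T) p -> (size p <= 2)%N].

Definition shortest_path_tree (R : realType) (V : finType) (e : rel V)
    (X : {set V}) (x0 : V) (T : {set {set V}}) : Prop :=
  spanning_tree e X T
  /\ {in X, forall y, dist (adj T) X x0 y = dist e X x0 y :> \bar R}.

(** ** Orderings and queues *)

Definition ordering (V : finType) (Q : seq V) (A : {set V}) : Prop :=
  uniq Q /\ Q =i A.

(* The [i]-th entry of [s], counting from 1; [x0] is a dummy default. *)
Definition item (T : Type) (x0 : T) (s : seq T) (i : nat) : T := nth x0 s i.-1.

Definition append_new (T : eqType) (q : seq T) (y : T) : seq T :=
  if y \in q then q else rcons q y.

(* The queue obtained from the empty one by processing [s] in order. *)
Definition queue_of (T : eqType) (s : seq T) : seq T :=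
  foldl (@append_new T) [::] s.

(* Index of the first of the clusters [Xs 0], ..., [Xs m] containing [z]; the
   clusters are disjoint. *)
Definition cluster_index (V : finType) (m : nat) (Xs : nat -> {set V}) (z : V) :
    nat :=
  find (fun j => z \in Xs j) (iota 0 m.+1).

Definition ball_queue (V : finType) (Xs : nat -> {set V}) (Q : seq V) : seq V :=
  [seq z <- Q | z \in Xs 0%N].

Definition cone_queue (V : finType) (Xs : nat -> {set V}) (xs : nat -> V)
    (Q : seq V) (l : nat) : seq V :=
  [seq z <- Q | (z \in Xs l) && (z != xs l)].

Definition reg_queue (V : finType) (m : nat) (Xs : nat -> {set V})
    (ys : nat -> V) (Q : seq V) : seq V :=
  queue_of [seq ys (cluster_index m Xs z) | z <- Q & z \notin Xs 0%N].

Definition fat_queue (R : realType) (V : finType) (x0 : V) (m : nat)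
    (Xs : nat -> {set V}) (ys : nat -> V) (Q : seq V) : seq V :=
  let l i := cluster_index m Xs (item x0 Q i) in
  queue_of [seq ys (l i) | i <- iota 1 (size Q) &
    (item x0 Q i \notin Xs 0%N)
    && (Num.sqrt (i%:R : R) < #|Xs (l i) :&: [set z in take i Q]|%:R)].

(** ** Algorithms

    A randomized algorithm is rendered as the relation between its input and
    the outputs it can return: a uniform choice from an interval becomes an
    arbitrary element of that (closed) interval. *)

(* The coin-tossing loop can stop at every index [h] with [1 <= h <= N]. *)
Definition cone_cut {R : realType} {V : finType} (e : rel V) (X : {set V})
    (x0 : V) (X0 Y : {set V}) (eps : R) (x y : V) (r : R) : Prop :=
  let chi (z : V) : R :=
    #|X|%:R / #|metric_ball Y (dist e Y) z ((eps / 16)%:E * graph_rad e x0 X)%E|%:R in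
  exists (p : V) (N h : nat),
    [/\ p \in Y /\ {in Y, forall z, chi p <= chi z},
        [/\ x \in Y, y \in X0, e y x
          & (dist e X x0 y + dist e X y x + dist e Y x p
             = dist e X x0 p :> \bar R)%E],
        N%:Z = Num.ceil (2 * log2 (chi p)),
        (1 <= h <= N)%N
      & let w := (eps / 2 - eps / 4) / N%:R in
        eps / 4 + (h%:R - 1) * w <= r <= eps / 4 + h%:R * w].

(* [ball], [fat], [reg]: the three queues of the central ball. *)
Definition interleaving (V : finType) (x0 : V) (ball fat reg Q0 : seq V) :
    Prop :=
  forall q, q \in [:: ball; fat; reg] ->
  forall i, (1 <= i <= size q)%N -> item x0 q i \in take (3 * i) Q0.

(* Index 0 is the central ball, with [xs 0 = x0]; [ys 0] is irrelevant. *)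
Definition star_partition {R : realType} {V : finType} (e : rel V) (c : R)
    (eps : {set V} -> R) (X : {set V}) (x0 : V) (Q : seq V)
    (m : nat) (Xs : nat -> {set V}) (xs ys : nat -> V) (Qs : nat -> seq V) :
    Prop :=
  let Delta : \bar R := graph_rad e x0 X in
  let z1 := item x0 Q 1 in
  exists (r : nat -> R) (Ys : nat -> {set V}),
    [/\ (* central ball *)
        [/\ 1 / (16 * c) <= r 0%N <= 1 / (8 * c),
            xs 0%N = x0,
            Xs 0%N = metric_ball X (dist e X) x0 ((r 0%N)%:E * Delta)%E
          & Ys 0%N = X :\: Xs 0%N],
        (* first cone *)
        [/\ exists z, [/\ z \in Ys 0%N, (z1 \in Ys 0%N -> z = z1),
              [/\ ys 1%N \in Xs 0%N, xs 1%N \in Ys 0%N & e (ys 1%N) (xs 1%N)]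
            & (dist e X x0 z = dist e X x0 (ys 1%N) + dist e X (ys 1%N) (xs 1%N)
                               + dist e (Ys 0%N) (xs 1%N) z :> \bar R)%E],
            eps X / 4 <= r 1%N <= eps X / 2,
            Xs 1%N = metric_ball (Ys 0%N)
              (cone_metric e X (Ys 0%N) x0 (xs 1%N)) (xs 1%N)
              ((r 1%N)%:E * Delta)%E
          & Ys 1%N = Ys 0%N :\: Xs 1%N],
        (* remaining cones, until nothing is left *)
        [/\ (1 <= m)%N,
            forall j, (2 <= j <= m)%N ->
              [/\ Ys j.-1 != finset.set0,
                  cone_cut e X x0 (Xs 0%N) (Ys j.-1) (eps X)
                    (xs j) (ys j) (r j),
                  Xs j = metric_ball (Ys j.-1)
                    (cone_metric e (Ys j.-1 :|: Xs 0%N) (Ys j.-1) x0 (xs j))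
                    (xs j) ((r j)%:E * Delta)%E
                & Ys j = Ys j.-1 :\: Xs j]
          & Ys m = finset.set0],
        (* orderings of the cones *)
        forall j, (1 <= j <= m)%N -> Qs j = cone_queue Xs xs Q j
      & (* ordering of the central ball *)
        [/\ ordering (Qs 0%N) (Xs 0%N :\ x0),
            ohead (Qs 0%N) = Some (if z1 \in Xs 0%N then z1 else ys 1%N)
          & interleaving x0 (ball_queue Xs Q) (fat_queue R x0 m Xs ys Q)
              (reg_queue m Xs ys Q) (Qs 0%N)]].

Inductive hierarchical_star_partition {R : realType} {V : finType} (e : rel V)
    (c : R) (eps : {set V} -> R) :
    {set V} -> V -> seq V -> {set {set V}} -> Prop :=
| hsp_base (X : {set V}) (x0 : V) (Q : seq V) (T : {set {set V}}) :
    (graph_rad e x0 X <= (16 * c)%:E)%E ->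
    shortest_path_tree R e X x0 T ->
    hierarchical_star_partition e c eps X x0 Q T
| hsp_star (X : {set V}) (x0 : V) (Q : seq V)
    (m : nat) (Xs : nat -> {set V}) (xs ys : nat -> V) (Qs : nat -> seq V)
    (Ts : nat -> {set {set V}}) :
    ((16 * c)%:E < graph_rad e x0 X)%E ->
    star_partition e c eps X x0 Q m Xs xs ys Qs ->
    (forall j, (j <= m)%N ->
       hierarchical_star_partition e c eps (Xs j) (xs j) (Qs j) (Ts j)) ->
    hierarchical_star_partition e c eps X x0 Q
      ((\bigcup_(0 <= j < m.+1) Ts j)
       :|: \bigcup_(1 <= j < m.+1) [set [set ys j; xs j]]).

(* Main.v *)
Require Import Defs.
From mathcomp Require Import all_boot all_order all_algebra.
From mathcomp Require Import all_classical all_reals all_analysis.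
From mathcomp Require Import zify ring lra.

Set Implicit Arguments.
Unset Strict Implicit.
Unset Printing Implicit Defensive.

Import Order.TTheory GRing.Theory Num.Theory.
Local Open Scope ring_scope.

(** Write [D] for the radius of [X], [f i] for the claimed stretch, and induct on
    the run of the algorithm.  Cutting off a cone never destroys a shortest path
    from [x0] to a surviving vertex, so every cone [X_l] satisfies
    [d_X(x0, x_l) + rad(X_l) <= (1 + eps/2) D], while [d_X(x0, x_l) > r0 D] and
    [rad(X_0) <= r0 D].  A vertex [z_i] of [X_l] is at most [i]-th in the queue of
    its cone and its portal [y_l] is among the first [3i] of the ball, which is
    enough for [i < c] (if all of [z_1, ..., z_i] lie in [X_l], then [l = 1] and
    [y_1] comes first).  For [i >= c] one gains a constant in [log log] on one of
    the two halves of the path: if the cone contains at most [sqrt i] of the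
    [z_1, ..., z_i], then [z_i] is at most [sqrt i]-th in its cone; otherwise
    [y_l] is among the first [2 sqrt i] fat portals, and the gain [c r0 / 2 >= 1/32]
    beats the loss [c eps (log log i) / 2 <= 1/340]. *)

(** * Distances in induced subgraphs *)

Lemma walk_cat (V : finType) (e : rel V) (Z : {set V}) x y z p q :
  walk e Z x y p -> walk e Z y z q -> walk e Z x z (p ++ q).
Proof.
case/and3P=> px /eqP ly ap /and3P[qy lz /= /andP[_ aq]].
by rewrite /walk cat_path px ly qy last_cat ly lz -cat_cons all_cat ap.
Qed.

Lemma walk_mono (V : finType) (e e' : rel V) (Z Z' : {set V}) x y p :
  subrel e e' -> Z \subset Z' -> walk e Z x y p -> walk e' Z' x y p.
Proof.
move=> ee' /fintype.subsetP ZZ' /and3P[px ly ap]; rewrite /walk (sub_path ee' px) ly /=.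
by apply: sub_all ap => u; apply: ZZ'.
Qed.

Lemma walk_rev (V : finType) (e : rel V) (Z : {set V}) x y p :
  symmetric e -> walk e Z x y p -> walk e Z y x (rev (belast x p)).
Proof.
move=> e_sym /and3P[px /eqP ly ap]; rewrite /walk -ly rev_path.
rewrite -(eq_path (e := e)) => [|u v]; last by rewrite e_sym.
rewrite px -rev_rcons -lastI all_rev ap andbT.
by case: p {px ly ap} => //= a p; rewrite rev_cons last_rcons.
Qed.

Lemma walk_mem (V : finType) (e : rel V) (Z : {set V}) x y p :
  walk e Z x y p -> x \in Z /\ y \in Z.
Proof.
case/and3P=> _ /eqP <- /allP ap; split; apply: ap; first exact: mem_head.
exact: mem_last.
Qed.

Lemma walk1 (V : finType) (e : rel V) (Z : {set V}) x y :
  x \in Z -> y \in Z -> e x y -> walk e Z x y [:: y].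
Proof. by move=> xZ yZ xy; rewrite /walk /= xy eqxx xZ yZ. Qed.

(** Distance as a relation with natural values: no [n] qualifies when [y] is unreachable, which is
    where [dist] is [+oo]. Metric arguments thus avoid extended reals. *)
Definition is_dist (V : finType) (e : rel V) (Z : {set V}) (x y : V) (n : nat) :=
  (exists2 p, walk e Z x y p & size p = n)
  /\ forall p, walk e Z x y p -> (n <= size p)%N.

Lemma is_dist_exists (V : finType) (e : rel V) (Z : {set V}) x y p :
  walk e Z x y p -> exists n, is_dist e Z x y n.
Proof.
move=> wp; have ex : exists n, `[< exists2 q, walk e Z x y q & size q = n >].
  by exists (size p); apply/asboolP; exists p.
case: (ex_minnP ex) => n /asboolP[q wq sq] nmin; exists n.
by split=> [|q' wq']; [exists q | apply/nmin/asboolP; exists q'].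
Qed.

Lemma is_dist_inj (V : finType) (e : rel V) (Z : {set V}) x y n m :
  is_dist e Z x y n -> is_dist e Z x y m -> n = m.
Proof.
move=> [[p wp <-] minn_] [[q wq <-] minm_].
by apply/eqP; rewrite eqn_leq minn_ ?minm_.
Qed.

Lemma is_dist_mem (V : finType) (e : rel V) (Z : {set V}) x y n :
  is_dist e Z x y n -> x \in Z /\ y \in Z.
Proof. by case=> -[p /walk_mem]. Qed.

Lemma is_dist_refl (V : finType) (e : rel V) (Z : {set V}) x :
  x \in Z -> is_dist e Z x x 0.
Proof. by move=> xZ; split=> //; exists [::] => //; rewrite /walk /= eqxx xZ. Qed.

Lemma is_dist0 (V : finType) (e : rel V) (Z : {set V}) x y :
  is_dist e Z x y 0 -> x = y.
Proof. by case=> -[[|//] /and3P[_ /eqP]]. Qed.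

Lemma is_dist1 (V : finType) (e : rel V) (Z : {set V}) x y :
  x \in Z -> y \in Z -> x != y -> e x y -> is_dist e Z x y 1.
Proof.
move=> xZ yZ xNy exy; split; first by exists [:: y]; rewrite ?walk1.
by case=> // /and3P[_ /=]; rewrite (negPf xNy).
Qed.

Lemma is_dist_triangle (V : finType) (e : rel V) (Z : {set V}) x y z n m k :
  is_dist e Z x y n -> is_dist e Z y z m -> is_dist e Z x z k -> (k <= n + m)%N.
Proof.
move=> [[p wp <-] _] [[q wq <-] _] [_ kmin].
by rewrite -size_cat kmin// (walk_cat wp wq).
Qed.

Lemma is_dist_edge (V : finType) (e : rel V) (Z : {set V}) x u v n m :
  e u v -> is_dist e Z x u n -> v \in Z -> is_dist e Z x v m -> (m <= n.+1)%N.
Proof.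
move=> uv [[p wp <-] _] vZ [_ mmin]; have [_ uZ] := walk_mem wp.
by rewrite -addn1 -(size_cat p [:: v]) mmin// (walk_cat wp)// walk1.
Qed.

Lemma is_dist_sub (V : finType) (e : rel V) (Z Z' : {set V}) x y n m :
  Z \subset Z' -> is_dist e Z x y n -> is_dist e Z' x y m -> (m <= n)%N.
Proof. by move=> ZZ' [[p wp <-] _] [_]; apply; apply: walk_mono wp. Qed.

Lemma is_dist_pred (V : finType) (e : rel V) (Z : {set V}) x y n :
  is_dist e Z x y n.+1 -> exists2 u, e u y & is_dist e Z x u n.
Proof.
case=> -[p wp sp] pmin; case/lastP: p wp sp pmin => [//|p u].
rewrite size_rcons => /and3P[]; rewrite rcons_path last_rcons -rcons_cons all_rcons.
move=> /andP[pp eu] /eqP <- /andP[uZ ap] [sp] pmin; exists (last x p) => //.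
split=> [|q wq]; first by exists p => //; rewrite /walk pp eqxx.
have wu : walk e Z (last x p) u [:: u].
  by rewrite walk1//; apply: (allP ap); exact: mem_last.
by have := pmin _ (walk_cat wq wu); rewrite size_cat addn1.
Qed.

(** A shortest walk can be shortened to one without repeated vertices. A cluster of radius above
    [16 c] therefore has more than [c] vertices, so that [loglog] of its size is at least 4. *)
Lemma is_dist_lt_card (V : finType) (e : rel V) (Z : {set V}) x y n :
  is_dist e Z x y n -> (n < #|Z|)%N.
Proof.
case=> -[p /and3P[px ly /allP ap] _] nmin.
case: (shortenP px) ly nmin => p' px' up' sp' ly nmin.
have wp' : walk e Z x y p'.
  rewrite /walk px' ly; apply/allP => u; rewrite inE => /predU1P[->|/sp' up].
    by apply: ap; rewrite mem_head.
  by apply: ap; rewrite inE up orbT.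
apply: leq_trans (_ : (size p').+1 <= _)%N; first by rewrite ltnS nmin.
rewrite -[(size p').+1]/(size (x :: p')) -(card_uniqP up').
apply: subset_leq_card; apply/fintype.subsetP => u.
by case/and3P: wp' => _ _ /allP; apply.
Qed.

(** Trace a shortest path of [X] backwards from [z]: the closure hypothesis keeps each predecessor
    in [W], so the whole path lies in [W]. *)
Lemma is_dist_closed (V : finType) (e : rel V) (X W : {set V}) x z n :
  W \subset X -> x \in W ->
  (forall u v k, v \in W -> e u v -> is_dist e X x u k -> is_dist e X x v k.+1 ->
     u \in W) ->
  z \in W -> is_dist e X x z n -> is_dist e W x z n.
Proof.
move=> WX xW Wcl zW dz; have lb k : is_dist e W x z k -> (n <= k)%N.
  by move=> dk; apply: is_dist_sub WX dk dz.
suff [p wp sp] : exists2 p, walk e W x z p & size p = n.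
  split=> [|q wq]; first by exists p.
  by case: dz => _; apply; apply: walk_mono wq.
elim: n z zW dz {lb} => [|n IHn] z zW dz.
  by exists [::] => //; rewrite -(is_dist0 dz) /walk /= eqxx xW.
have [u uz du] := is_dist_pred dz.
have uW : u \in W by apply: Wcl zW uz du dz.
have [p wp sp] := IHn u uW du.
exists (p ++ [:: z]); last by rewrite size_cat sp addn1.
by apply: walk_cat wp _; apply: walk1.
Qed.

Lemma is_dist_connected (V : finType) (e : rel V) (Z : {set V}) x :
  symmetric e -> (forall z, z \in Z -> exists n, is_dist e Z x z n) ->
  graph_connected e Z.
Proof.
move=> e_sym Zx u v /Zx[n [[p wp _] _]] /Zx[m [[q wq _] _]].
by exists (rev (belast x p) ++ q); apply: walk_cat wq; apply: walk_rev.
Qed.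

Lemma dist_is_dist (R : realType) (V : finType) (e : rel V) (Z : {set V}) x y n :
  is_dist e Z x y n -> dist e Z x y = (n%:R : R)%:E.
Proof.
move=> [[p wp sp] nmin]; apply/eqP; rewrite eq_le; apply/andP; split.
  by apply: ereal_inf_lbound; exists p; rewrite ?sp.
by apply: le_ereal_inf_tmp => _ [q wq <-]; rewrite lee_fin ler_nat nmin.
Qed.

Lemma dist_pinfty (R : realType) (V : finType) (e : rel V) (Z : {set V}) x y :
  ~ (exists n, is_dist e Z x y n) -> dist e Z x y = +oo%E :> \bar R.
Proof.
move=> nd; rewrite /dist (_ : [set _ | _ in _]%classic = classical_sets.set0).
  by rewrite ereal_inf0.
apply/seteqP; split=> // t [p wp _]; apply: nd; exact: is_dist_exists wp.
Qed.

Lemma dist_le_is_dist (R : realType) (V : finType) (e : rel V) (Z : {set V}) x y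
    (b : R) :
  (dist e Z x y <= b%:E)%E -> exists2 n, is_dist e Z x y n & n%:R <= b.
Proof.
have [[n dn]|/dist_pinfty->//] := pselect (exists n, is_dist e Z x y n).
by rewrite (dist_is_dist R dn) lee_fin; exists n.
Qed.

Lemma graph_radP (R : realType) (V : finType) (e : rel V) (Z : {set V}) x :
  x \in Z -> graph_connected e Z -> exists D, [/\ graph_rad e x Z = (D%:R : R)%:E,
    forall z n, is_dist e Z x z n -> (n <= D)%N
    & exists z, is_dist e Z x z D].
Proof.
move=> xZ Zc.
have [d dP] : exists d : V -> nat, forall z, z \in Z -> is_dist e Z x z (d z).
  have /choice[d dP] : forall z, exists n, z \in Z -> is_dist e Z x z n.
    move=> z; have [zZ|zZ] := boolP (z \in Z); last by exists 0%N.
    by have [p /is_dist_exists[n dn]] := Zc _ _ xZ zZ; exists n.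
  by exists d.
have [y yZ ymax] : exists2 y, y \in Z & forall z, z \in Z -> (d z <= d y)%N.
  by have [y yZ ymax] := @arg_maxnP _ x (mem Z) d xZ; exists y.
exists (d y); split; last by exists y; exact: dP.
  apply/eqP; rewrite eq_le; apply/andP; split.
    apply: bigmax_le => [|z zZ]; first by rewrite leNye.
    by rewrite (dist_is_dist R (dP _ zZ)) lee_fin ler_nat ymax.
  by rewrite -(dist_is_dist R (dP _ yZ)); apply: le_bigmax_cond.
move=> z n dn; have [_ zZ] := is_dist_mem dn.
by rewrite (is_dist_inj dn (dP _ zZ)); exact: ymax.
Qed.

(** * Iterated logarithms *)

Lemma log2X2 (R : realType) (x : R) : 0 < x -> log2 (x ^+ 2) = 2 * log2 x.
Proof. by move=> x0; rewrite /log2 lnXn// -[ln x *+ 2]mulr_natl mulrA. Qed.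

Lemma log2M (R : realType) (x y : R) :
  0 < x -> 0 < y -> log2 (x * y) = log2 x + log2 y.
Proof. by move=> x0 y0; rewrite /log2 lnM// mulrDl. Qed.

Lemma ln2_gt0 (R : realType) : 0 < ln 2 :> R.
Proof. by rewrite ln_gt0// ltr1n. Qed.

Lemma log2_natX (R : realType) n : log2 (2 ^+ n : R) = n%:R.
Proof.
by rewrite /log2 lnXn// -[ln 2 *+ n]mulr_natl mulfK// gt_eqF// ln2_gt0.
Qed.

Lemma le_log2 (R : realType) (x y : R) : 0 < x -> x <= y -> log2 x <= log2 y.
Proof.
move=> x0 xy; rewrite /log2 ler_pM2r ?invr_gt0 ?ln2_gt0//.
by rewrite ler_ln// posrE// (lt_le_trans x0).
Qed.

Definition loglog {R : realType} (n : nat) : R := log2 (log2 n%:R).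

(** For [c = 2 ^ 16] the value at [i = 1] is 1, so the exact distance claimed there also obeys the
    radius bound; at [i = c] the value jumps up from below [c] to [4 c], which preserves
    monotonicity. *)
Definition stretch {R : realType} (c i : nat) : R :=
  if (i < c)%N then i%:R else c%:R * loglog i.

Lemma log2_ge16 (R : realType) (c i : nat) :
  c = (2 ^ 16)%N -> (c <= i)%N -> 16 <= log2 (i%:R : R).
Proof.
move=> hc ci; rewrite -(log2_natX R 16); apply: le_log2; first by rewrite exprn_gt0.
by rewrite -natrX -hc ler_nat.
Qed.

Lemma loglog_ge4 (R : realType) (c i : nat) :
  c = (2 ^ 16)%N -> (c <= i)%N -> 4 <= loglog i :> R.
Proof.
move=> hc /(log2_ge16 R hc) i16; rewrite -(log2_natX R 4).
by apply: le_log2; rewrite ?exprn_gt0// -natrX.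
Qed.

Lemma loglog_c (R : realType) (c : nat) : c = (2 ^ 16)%N -> loglog c = 4 :> R.
Proof.
move=> ->; rewrite /loglog natrX log2_natX.
by rewrite (_ : 16 = 2 ^+ 4) ?log2_natX// -natrX.
Qed.

Lemma le_loglog (R : realType) (c i j : nat) :
  c = (2 ^ 16)%N -> (c <= i)%N -> (i <= j)%N -> loglog i <= loglog j :> R.
Proof.
move=> hc ci ij; have i16 := log2_ge16 R hc ci.
apply: le_log2; first lra.
by apply: le_log2; rewrite ?ler_nat// ltr0n; lia.
Qed.

Lemma loglog_sqr (R : realType) (c i : nat) :
  c = (2 ^ 16)%N -> (c <= i)%N -> loglog (i ^ 2) = loglog i + 1 :> R.
Proof.
move=> hc ci; have i16 := log2_ge16 R hc ci.
rewrite /loglog natrX log2X2; last by rewrite ltr0n; lia.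
by have := log2_natX R 1; rewrite expr1 => l2; rewrite log2M ?l2 1?addrC//; lra.
Qed.

Lemma c_ge1024 (c : nat) : c = (2 ^ 16)%N -> (1024 <= c)%N.
Proof. by move=> ->; rewrite -[1024%N]/(2 ^ 10)%N leq_exp2l. Qed.

Lemma le_stretch (R : realType) (c i j : nat) : c = (2 ^ 16)%N ->
  (i <= j)%N -> stretch c i <= stretch c j :> R.
Proof.
move=> hc ij; rewrite /stretch; case: ltnP => ic; case: ltnP => jc.
- by rewrite ler_nat.
- have := loglog_ge4 R hc jc; have : i%:R <= c%:R :> R by rewrite ler_nat ltnW.
  have : 0 <= c%:R :> R by []. nra.
- by have := leq_trans ic (leq_trans ij (ltnW jc)); rewrite leqNgt; lia.
- by rewrite ler_wpM2l// (le_loglog _ hc).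
Qed.

Lemma stretch_ge (R : realType) (c i : nat) :
  (c <= i)%N -> stretch c i = c%:R * loglog i :> R.
Proof. by move=> ci; rewrite /stretch ltnNge ci. Qed.

Lemma stretch_ge0 (R : realType) (c i : nat) :
  c = (2 ^ 16)%N -> 0 <= stretch c i :> R.
Proof.
move=> hc; rewrite /stretch; case: ltnP => // ci.
by have := loglog_ge4 R hc ci => ?; rewrite mulr_ge0//; lra.
Qed.

(** Here [3 i <= c ^ 2], and squaring [c] raises [loglog] from 4 to 5. *)
Lemma stretch3_lt (R : realType) (c i : nat) : c = (2 ^ 16)%N ->
  (i < c)%N -> stretch c (3 * i) <= 5 * c%:R :> R.
Proof.
move=> hc ic; have c1024 := c_ge1024 hc.
apply: (@le_trans _ _ (stretch c (c ^ 2))).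
  by apply: le_stretch => //; nia.
rewrite stretch_ge//; last by nia.
by rewrite (loglog_sqr R hc)// loglog_c// mulrC; lra.
Qed.

Lemma stretch3_ge (R : realType) (c i : nat) : c = (2 ^ 16)%N ->
  (c <= i)%N -> stretch c (3 * i) <= c%:R * (loglog i + 1) :> R.
Proof.
move=> hc ci; have c1024 := c_ge1024 hc.
apply: (@le_trans _ _ (stretch c (i ^ 2))).
  by apply: le_stretch => //; nia.
by rewrite stretch_ge ?(loglog_sqr R hc)//; nia.
Qed.

(** If [k >= c], squaring [k] adds 1 to [loglog] and still stays below [i]; if [k < c], the value is
    at most [c], while [loglog i - 1 >= 3]. *)
Lemma stretch_sqrt (R : realType) (c i k : nat) : c = (2 ^ 16)%N ->
  (c <= i)%N -> (k ^ 2 <= i)%N -> stretch c k <= c%:R * (loglog i - 1) :> R.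
Proof.
move=> hc ci ki; have L4 := loglog_ge4 R hc ci.
have c0 : 0 <= c%:R :> R by [].
rewrite /stretch; case: ltnP => [kc|ck].
  have : k%:R <= c%:R :> R by rewrite ler_nat ltnW.
  nra.
rewrite ler_wpM2l// lerBrDr -(loglog_sqr R hc ck).
by apply: le_loglog ki => //; have := c_ge1024 hc; nia.
Qed.

(** Since [s ^ 2 <= 36 i <= 64 i], the logarithm of [s] is at most half that of [i] plus 3, hence
    smaller by a factor of more than [sqrt 2]; this gains 1/2 after the second logarithm. *)
Lemma stretch_fat (R : realType) (c i t s : nat) : c = (2 ^ 16)%N ->
  (c <= i)%N -> (t ^ 2 <= 4 * i)%N -> (s <= 3 * t)%N ->
  stretch c s <= c%:R * (loglog i - 1 / 2) :> R.
Proof.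
move=> hc ci ti st; have L4 := loglog_ge4 R hc ci.
have c0 : 0 <= c%:R :> R by [].
rewrite /stretch; case: ltnP => [sc|cs].
  have : s%:R <= c%:R :> R by rewrite ler_nat ltnW.
  nra.
rewrite ler_wpM2l//.
have s16 := log2_ge16 R hc cs; have i16 := log2_ge16 R hc ci.
have ls : 2 * log2 s%:R <= log2 i%:R + 6 :> R.
  rewrite -log2X2; last by rewrite ltr0n; have := c_ge1024 hc; lia.
  rewrite -(log2_natX R 6) -log2M ?exprn_gt0//; last first.
    by rewrite ltr0n; have := c_ge1024 hc; lia.
  apply: le_log2; first by rewrite exprn_gt0// ltr0n; have := c_ge1024 hc; lia.
  rewrite -!natrX -natrM ler_nat -[(2 ^ 6)%N]/64%N; nia.
have l2 : log2 2 = 1 :> R by have := log2_natX R 1; rewrite expr1.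
suff : 2 * loglog s + 1 <= 2 * loglog i :> R by lra.
have s0 : 0 < log2 (s%:R : R) by lra.
have i0 : 0 < log2 (i%:R : R) by lra.
rewrite /loglog -!log2X2// -[X in _ + X <= _]l2 -log2M ?exprn_gt0//.
apply: le_log2; first by rewrite mulr_gt0 ?exprn_gt0.
(* As [log2 i >= 16], the summand 3 is at most 3/16 of it, and 1/2 + 3/16 = 11/16. The goal then
   follows from [2 * (11/16)^2 = 242/256 < 1]. *)
have : log2 s%:R ^+ 2 <= (11 / 16 * log2 i%:R) ^+ 2 :> R.
  by apply: lerXn2r; rewrite ?nnegrE; lra.
by rewrite exprMn; have := sqr_ge0 (log2 (i%:R : R)); lra.
Qed.

(** * Queues *)

Lemma take_item (T : Type) (x0 : T) (s : seq T) (i : nat) :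
  (1 <= i <= size s)%N -> take i s = rcons (take i.-1 s) (item x0 s i).
Proof. by case: i => // i /andP[_ lt_is]; rewrite -take_nth. Qed.

Lemma mem_item (T : eqType) (x0 : T) (s : seq T) (i : nat) :
  (1 <= i <= size s)%N -> item x0 s i \in s.
Proof. by move=> ilt; apply: mem_nth; lia. Qed.

Lemma mem_take_item (T : eqType) (x0 : T) (s : seq T) (n : nat) (y : T) :
  y \in take n s ->
  exists i, [/\ (1 <= i <= size s)%N, (i <= n)%N & item x0 s i = y].
Proof.
move=> ys; have := ys; rewrite -index_mem size_take_min leq_min => /andP[ilt ilt'].
exists (index y (take n s)).+1; split=> //.
by rewrite /item /= -(nth_take _ ilt) nth_index.
Qed.

Lemma item_filter (T : Type) (x0 : T) (p : pred T) (s : seq T) (i : nat) :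
  (1 <= i <= size s)%N -> p (item x0 s i) ->
  let k := count p (take i s) in
  [/\ (1 <= k <= size [seq x <- s | p x])%N, (k <= i)%N
    & item x0 [seq x <- s | p x] k = item x0 s i].
Proof.
move=> ilt pz k; have ti := take_item x0 ilt.
have kE : k = (count p (take i.-1 s)).+1.
  by rewrite /k ti -cats1 count_cat /= pz addn0 addn1.
have fE : [seq x <- s | p x] =
    [seq x <- take i.-1 s | p x] ++ item x0 s i :: [seq x <- drop i s | p x].
  by rewrite -{1}(cat_take_drop i s) filter_cat ti filter_rcons pz cat_rcons.
split.
- by rewrite fE size_cat size_filter kE /= addnS ltnS leq_addr.
- by apply: leq_trans (count_size _ _) _; rewrite size_take_min geq_minl.
- by rewrite {1}/item fE nth_cat size_filter kE /= ltnn subnn.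
Qed.

Lemma foldl_append_new (T : eqType) (q s : seq T) :
  exists r, foldl (@append_new T) q s = q ++ r.
Proof.
elim: s q => [|y s IHs] q /=; first by exists [::]; rewrite cats0.
have [r ->] := IHs (append_new q y); rewrite /append_new.
by case: ifP => _; [exists r | exists (y :: r); rewrite cat_rcons].
Qed.

Lemma queue_of_rcons (T : eqType) (s : seq T) y :
  queue_of (rcons s y) = append_new (queue_of s) y.
Proof. by rewrite /queue_of foldl_rcons. Qed.

Lemma mem_queue_of (T : eqType) (s : seq T) : queue_of s =i s.
Proof.
elim/last_ind: s => // s y IHs z; rewrite queue_of_rcons /append_new mem_rcons inE.
case: ifP => [ys|_]; last by rewrite mem_rcons inE IHs.
by rewrite -IHs; case: eqP => // ->; rewrite ys.
Qed.

Lemma size_queue_of (T : eqType) (s : seq T) : (size (queue_of s) <= size s)%N.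
Proof.
elim/last_ind: s => // s y IHs; rewrite queue_of_rcons /append_new size_rcons.
by case: ifP => _; rewrite ?size_rcons// leqW.
Qed.

(** Processing only appends at the end, so what [s1] has put into the queue keeps its position while
    [s2] is processed. *)
Lemma item_queue_of (T : eqType) (x0 : T) (s1 s2 : seq T) (y : T) :
  y \in s1 -> exists k, [/\ (1 <= k <= size (queue_of (s1 ++ s2)))%N,
    (k <= size (queue_of s1))%N & item x0 (queue_of (s1 ++ s2)) k = y].
Proof.
move=> ys1; have [r rE] := foldl_append_new (queue_of s1) s2.
have -> : queue_of (s1 ++ s2) = queue_of s1 ++ r by rewrite /queue_of foldl_cat.
have yq : y \in queue_of s1 by rewrite mem_queue_of.
have lt_y : (index y (queue_of s1) < size (queue_of s1))%N by rewrite index_mem.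
exists (index y (queue_of s1)).+1; split=> //; first by rewrite size_cat; lia.
by rewrite /item /= nth_cat lt_y nth_index.
Qed.

(* A new fat portal is added at time [n] together with more than [sqrt n] entries
   whose portal was not counted before; hence the number [u] of entries already
   assigned to the queue satisfies [4 u >= t ^ 2] when the queue has size [t]. *)
Lemma sqr_size_queue_of (T T' : eqType) (x0 : T) (g : T -> T') (fat : pred nat)
    (Q : seq T) :
  (forall n, (1 <= n <= size Q)%N -> fat n ->
     (n < count (fun z => g z == g (item x0 Q n)) (take n Q) ^ 2)%N) ->
  forall n, (n <= size Q)%N ->
    (size (queue_of [seq g (item x0 Q i) | i <- iota 1 n & fat i]) ^ 2
       <= 4 * n)%N.
Proof.
move=> fatP n nQ.
pose F k := queue_of [seq g (item x0 Q i) | i <- iota 1 k & fat i].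
have cnt_le k p : (count p (take k Q) <= k)%N.
  by apply: leq_trans (count_size _ _) _; rewrite size_take_min geq_minl.
suff : (size (F n) ^ 2 <= 4 * count (fun z => g z \in F n) (take n Q))%N.
  by move=> /leq_trans; apply; rewrite leq_mul2l cnt_le.
elim: n nQ => [|n IHn] nQ; first by rewrite take0.
have {}IHn := IHn (ltnW nQ).
have ti : take n.+1 Q = rcons (take n Q) (item x0 Q n.+1) by apply: take_item; lia.
have FE : F n.+1 = if fat n.+1 then append_new (F n) (g (item x0 Q n.+1)) else F n.
  rewrite /F -[n.+1]addn1 iotaD filter_cat map_cat /= add1n addn1.
  by case: ifP => _; rewrite ?cats0// cats1 queue_of_rcons.
have mono : (size (F n) ^ 2 <= 4 * count (fun z => g z \in F n) (take n.+1 Q))%N.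
  by apply: leq_trans IHn _; rewrite leq_mul2l ti -cats1 count_cat leq_addr.
rewrite FE; case: ifP => // fatn; rewrite /append_new; case: ifPn => // gF.
have {}fatP := fatP _ _ fatn; rewrite size_rcons.
set u := count (fun z => g z \in F n) (take n.+1 Q) in mono.
set v := count (fun z => g z == g (item x0 Q n.+1)) (take n.+1 Q) in fatP.
(* The two counted sets are disjoint because the new portal is not yet in [F n]. *)
have -> : count (fun z => g z \in rcons (F n) (g (item x0 Q n.+1))) (take n.+1 Q)
    = (u + v)%N.
  rewrite /u /v -count_predUI [X in (_ + X)%N](_ : _ = 0)%N ?addn0.
    by apply: eq_count => z; rewrite /= mem_rcons inE orbC.
  apply/eqP; rewrite -leqn0 leqNgt -has_count; apply/hasPn => z _ /=.
  by rewrite negb_and orbC; case: eqP => //= ->.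
have uv : (u + v <= n.+1)%N.
  rewrite /u /v -count_predUI [X in (_ + X)%N](_ : _ = 0)%N ?addn0 ?cnt_le//.
  apply/eqP; rewrite -leqn0 leqNgt -has_count; apply/hasPn => z _ /=.
  by rewrite negb_and orbC; case: eqP => //= ->.
have {fatP} vn : (n.+1 < v ^ 2)%N by apply: fatP; lia.
(* If [2 v] is at most the old size, then [v ^ 2 <= u <= n.+1], against [n.+1 < v ^ 2]. Otherwise
   the square of the size grows by at most [4 v]. *)
have [|v2] := leqP (2 * v) (size (F n)); nia.
Qed.

(** * Cones and star partitions *)

(** This is the closure hypothesis of [is_dist_closed]; a subset of [X] that contains [x] and
    satisfies it retains the distances from [x]. It is the invariant of the cone cutting. *)
Definition pred_closed (V : finType) (e : rel V) (X : {set V}) (x : V)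
    (W : {set V}) :=
  forall u v k, v \in W -> e u v -> is_dist e X x u k -> is_dist e X x v k.+1 ->
    u \in W.

(** The absolute value disappears: paths of [Y] are paths of [W], so the excess [a + k - n] is
    nonnegative by the triangle inequality. If [u] is unreachable in [Y], the cone metric is
    infinite. *)
Lemma mem_cone (R : realType) (V : finType) (e : rel V) (W Y : {set V})
    (x0 x u : V) (a n D : nat) (r : R) :
  Y \subset W -> x \in Y -> is_dist e W x0 x a -> is_dist e W x0 u n ->
  u \in metric_ball Y (cone_metric e W Y x0 x) x (r%:E * (D%:R)%:E)%E <->
  exists2 k, is_dist e Y x u k & a%:R + k%:R - n%:R <= r * D%:R.
Proof.
move=> YW xY dx du; have dxx := is_dist_refl e xY.
rewrite inE /cone_metric (dist_is_dist R dx) (dist_is_dist R du).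
rewrite (dist_is_dist R dxx); split=> [/andP[uY]|[k dk le_r]].
  have [[k dk]|/(dist_pinfty R) ->] := pselect (exists k, is_dist e Y x u k).
    rewrite (dist_is_dist R dk) -!EFinB -EFinM /= lee_fin => le_r; exists k => //.
    by apply: le_trans le_r; apply: le_trans (ler_norm _); rewrite /=; lra.
  by rewrite -EFinM.
have [_ uY] := is_dist_mem dk; rewrite uY (dist_is_dist R dk) -!EFinB -EFinM /= lee_fin.
have [[p wp sp] _] := dk.
have [k' dk'] := is_dist_exists (walk_mono (fun _ _ => id) YW wp).
have nak : n%:R <= a%:R + k%:R :> R.
  rewrite -natrD ler_nat; apply: leq_trans (is_dist_triangle dx dk' du) _.
  by rewrite leq_add2l (is_dist_sub YW dk dk').
by rewrite ger0_norm; lra.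
Qed.

(** Everything follows from the excess [d x + k - d z], with [k] the distance from [x] to [z] in
    [Y]. One step back along a shortest path from [x] lowers [k] by 1 and [d] by at most 1, so the
    cone contains its shortest paths from [x]. One step forward along a shortest path from [x0]
    raises [d] by 1 and [k] by at most 1, so a cone vertex cannot precede a surviving vertex of
    [Y]. *)
Lemma cone_step (R : realType) (V : finType) (e : rel V) (X X0 Y : {set V})
    (x0 x : V) (d : V -> nat) (D : nat) (r : R) :
  let W := Y :|: X0 in
  let C := metric_ball Y (cone_metric e W Y x0 x) x (r%:E * (D%:R)%:E)%E in
  symmetric e -> {in X, forall z, is_dist e X x0 z (d z)} ->
  X0 \subset X -> Y \subset X -> x0 \in X0 -> x \in Y -> 0 <= r ->
  pred_closed e X x0 X0 -> pred_closed e X x0 W ->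
  [/\ {in C, forall z, exists k, [/\ is_dist e C x z k, is_dist e Y x z k
        & (d x)%:R + k%:R <= (d z)%:R + r * D%:R]},
      pred_closed e X x0 (Y :\: C :|: X0), x \in C
    & forall z k, is_dist e Y x z k -> (d z = d x + k)%N -> z \in C].
Proof.
move=> W C e_sym dP X0X YX x0X0 xY r0 X0cl Wcl.
have WX : W \subset X by rewrite finset.subUset YX.
have x0W : x0 \in W by rewrite finset.in_setU x0X0 orbT.
have YW : Y \subset W by rewrite finset.subsetUl.
have dW z : z \in W -> is_dist e W x0 z (d z).
  by move=> zW; apply: (is_dist_closed WX x0W Wcl zW (dP _ (fintype.subsetP WX _ zW))).
have xW : x \in W by apply: (fintype.subsetP YW).
have CP z : z \in Y -> z \in C <->
    exists2 k, is_dist e Y x z k & (d x)%:R + k%:R - (d z)%:R <= r * D%:R.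
  by move=> zY; apply: mem_cone => //; apply: dW => //; apply: (fintype.subsetP YW).
have CY : C \subset Y by apply/fintype.subsetP => z; rewrite inE => /andP[].
have xC : x \in C.
  apply/CP => //; exists 0%N; first exact: is_dist_refl.
  by rewrite addr0 subrr mulr_ge0.
have edge u v : u \in X -> v \in X -> e u v -> (d v <= (d u).+1)%N.
  by move=> uX vX uv; apply: is_dist_edge uv (dP _ uX) vX (dP _ vX).
split=> //.
- move=> z zC; have zY := fintype.subsetP CY _ zC.
  have [k dk kle] := (CP z zY).1 zC; exists k; split=> //; last by lra.
  apply: (is_dist_closed CY xC _ zC dk) => u v l vC uv du dv.
  have [_ uY] := is_dist_mem du; have vY := fintype.subsetP CY _ vC.
  have [l' dl' l'le] := (CP v vY).1 vC; rewrite (is_dist_inj dl' dv) in l'le.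
  apply/CP => //; exists l => //.
  have := edge _ _ (fintype.subsetP YX _ uY) (fintype.subsetP YX _ vY) uv.
  rewrite -(ler_nat R) -natr1 => ?; rewrite -natr1 in l'le; lra.
- move=> u v k; rewrite !finset.in_setU => /orP[|vX0]; last first.
    by move=> uv du dv; rewrite (X0cl u v k) ?orbT.
  rewrite !finset.in_setD => /andP[vC vY] uv du dv.
  have : u \in W by apply: (Wcl u v k) => //; apply: (fintype.subsetP YW).
  rewrite finset.in_setU => /orP[uY|->]; last by rewrite orbT.
  rewrite uY andbT; case: (boolP (u \in C)) => // uC.
  have [l dl lle] := (CP u uY).1 uC.
  case/negP: vC; apply/CP => //.
  have [[p wp _] _] := dl.
  have [l' dl'] := is_dist_exists (walk_cat wp (walk1 uY vY uv)).
  have l'l := is_dist_edge uv dl vY dl'.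
  exists l' => //.
  have -> : d v = (d u).+1.
    rewrite (is_dist_inj (dP _ (fintype.subsetP YX _ vY)) dv).
    by rewrite (is_dist_inj (dP _ (fintype.subsetP YX _ uY)) du).
  by move: l'l; rewrite -(ler_nat R) -!natr1; lra.
- move=> z k dk dz; have [_ zY] := is_dist_mem dk.
  by apply/CP => //; exists k => //; rewrite dz natrD subrr mulr_ge0.
Qed.

(** By the equation, [d p] is [d y + 1 + k]. Since [d x <= d y + 1] and [d p <= d x + k], both
    inequalities must be equalities. *)
Lemma portal_dist (R : realType) (V : finType) (e : rel V) (X Y : {set V})
    (x0 x y p : V) (d : V -> nat) :
  irreflexive e -> {in X, forall z, is_dist e X x0 z (d z)} ->
  Y \subset X -> x \in Y -> y \in X -> p \in Y -> e y x ->
  (dist e X x0 y + dist e X y x + dist e Y x p = dist e X x0 p :> \bar R)%E ->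
  d x = (d y).+1 /\ exists2 k, is_dist e Y x p k & (d p = d x + k)%N.
Proof.
move=> e_irr dP YX xY yX pY eyx.
have xX := fintype.subsetP YX _ xY; have pX := fintype.subsetP YX _ pY.
have yNx : y != x by apply: contraTneq eyx => ->; rewrite e_irr.
rewrite (dist_is_dist R (dP _ yX)) (dist_is_dist R (is_dist1 yX xX yNx eyx)).
rewrite (dist_is_dist R (dP _ pX)).
have [[k dk]|/(dist_pinfty R) ->//] := pselect (exists k, is_dist e Y x p k).
rewrite (dist_is_dist R dk) -!EFinD => -[/eqP].
rewrite -!natrD eqr_nat => /eqP dpE.
have xle := is_dist_edge eyx (dP _ yX) xX (dP _ xX).
have [[q wq _] _] := dk.
have [k' dk'] := is_dist_exists (walk_mono (fun _ _ => id) YX wq).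
have := is_dist_triangle (dP _ xX) dk' (dP _ pX).
have := is_dist_sub YX dk dk' => ? ?.
have dxE : d x = (d y).+1 by lia.
by split=> //; exists k => //; lia.
Qed.

(** The interval [S_h] starts at or above [eps / 4] and, as [h <= N], ends at or below [eps / 2]. *)
Lemma cone_cut_portal (R : realType) (V : finType) (e : rel V) (X X0 Y : {set V})
    (x0 x y : V) (eps r : R) :
  0 < eps -> cone_cut e X x0 X0 Y eps x y r ->
  [/\ 0 <= r <= eps / 2, x \in Y, y \in X0, e y x & exists2 p, p \in Y &
     (dist e X x0 y + dist e X y x + dist e Y x p = dist e X x0 p :> \bar R)%E].
Proof.
move=> eps0 [p [N [h [[pY _] [xY yX0 eyx pE] _ /andP[h1 hN] /andP[rl ru]]]]].
split=> //; last by exists p.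
have N0 : 0 < N%:R :> R by rewrite ltr0n; lia.
have h1R : 1 <= h%:R :> R by rewrite ler1n.
have hNR : h%:R <= N%:R :> R by rewrite ler_nat.
move: rl ru; set w := _ / N%:R => rl ru.
have w0 : 0 <= w by rewrite divr_ge0//; lra.
have wN : N%:R * w = eps / 2 - eps / 4 by rewrite mulrC divfK// gt_eqF.
by apply/andP; split; nra.
Qed.

(** The facts about one partition on which the stretch bound rests, with all cone distances compared
    to the fixed function [d]. What remains after each cut, together with the central ball, stays
    [pred_closed], so [cone_step] applies to every cone in turn. The last clause holds because [z1]
    has excess 0 with respect to the first cone. *)
Lemma star_partitionP (R : realType) (V : finType) (e : rel V) (c : R)
    (eps : {set V} -> R) (X : {set V}) (x0 : V) (Q : seq V) (m : nat)
    (Xs : nat -> {set V}) (xs ys : nat -> V) (Qs : nat -> seq V) (D : nat) :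
  symmetric e -> irreflexive e -> graph_connected e X -> x0 \in X ->
  graph_rad e x0 X = (D%:R : R)%:E -> 0 < c -> 0 < eps X ->
  star_partition e c eps X x0 Q m Xs xs ys Qs ->
  exists (d : V -> nat) (r0 : R),
  [/\ {in X, forall z, is_dist e X x0 z (d z)} /\ 1 / (16 * c) <= r0 <= 1 / (8 * c),
      [/\ Xs 0%N \subset X, x0 \in Xs 0%N & {in Xs 0%N, forall z,
        is_dist e (Xs 0%N) x0 z (d z) /\ (d z)%:R <= r0 * D%:R}],
      forall j, (1 <= j <= m)%N ->
        [/\ Xs j \subset X, xs j \in Xs j, ys j \in Xs 0%N /\ e (ys j) (xs j),
            d (xs j) = (d (ys j)).+1 /\ r0 * D%:R < (d (xs j))%:R
          & {in Xs j, forall z, exists2 k, is_dist e (Xs j) (xs j) z k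
              & (d (xs j))%:R + k%:R <= (d z)%:R + eps X / 2 * D%:R}],
      (forall z, z \in X -> exists2 j, (j <= m)%N & z \in Xs j) /\
      (forall i j z, (i <= m)%N -> (j <= m)%N -> z \in Xs i -> z \in Xs j -> i = j)
    & let z1 := item x0 Q 1 in z1 \in X -> z1 \notin Xs 0%N ->
        z1 \in Xs 1%N /\ exists2 k, is_dist e (Xs 1%N) (xs 1%N) z1 k
          & d z1 = (d (xs 1%N) + k)%N].
Proof.
move=> e_sym e_irr Xc x0X radE c0 eps0 [r [Ys]].
rewrite radE => -[[r0P xs0 Xs0 Ys0] [[z [zY z1z [y1X x1Y e1] zE]] r1P Xs1 Ys1]
  [m1 cones Ysm] _ _].
have [d dP] : exists d : V -> nat, {in X, forall z, is_dist e X x0 z (d z)}.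
  have /choice[d dP] : forall z, exists n, z \in X -> is_dist e X x0 z n.
    move=> t; have [tX|tX] := boolP (t \in X); last by exists 0%N.
    by have [p /is_dist_exists[n dn]] := Xc _ _ x0X tX; exists n.
  by exists d.
exists d, (r 0%N).
have X0X : Xs 0%N \subset X.
  by rewrite Xs0; apply/fintype.subsetP => t; rewrite inE => /andP[].
have X0P t : t \in X -> (t \in Xs 0%N) = ((d t)%:R <= r 0%N * D%:R).
  by move=> tX; rewrite Xs0 inE tX (dist_is_dist R (dP _ tX)) -EFinM lee_fin.
have r00 : 0 <= r 0%N.
  by case/andP: r0P => + _; apply: le_trans; rewrite divr_ge0// mulr_ge0// ltW.
have x0X0 : x0 \in Xs 0%N.
  by rewrite X0P// (is_dist_inj (dP _ x0X) (is_dist_refl e x0X)) mulr_ge0.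
have X0cl : pred_closed e X x0 (Xs 0%N).
  move=> u v k vX0 uv du dv; have [_ uX] := is_dist_mem du.
  have vX := fintype.subsetP X0X _ vX0.
  move: vX0; rewrite (X0P _ uX) (X0P _ vX).
  rewrite (is_dist_inj (dP _ uX) du) (is_dist_inj (dP _ vX) dv).
  by apply: le_trans; rewrite ler_nat.
(* The first cone is defined with [X] in its metric, the later ones with [Ys j.-1 :|: Xs 0]; this
   identity treats them uniformly. *)
have Ys0X : Ys 0%N :|: Xs 0%N = X.
  apply/finset.setP => t; rewrite Ys0 finset.in_setU finset.in_setD.
  by case: (boolP (t \in Xs 0%N)) => [/(fintype.subsetP X0X)|_]; rewrite ?orbF.
have step j : (1 <= j <= m)%N ->
  [/\ [/\ 0 <= r j <= eps X / 2, xs j \in Ys j.-1, ys j \in Xs 0%N, e (ys j) (xs j)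
        & exists2 p, p \in Ys j.-1 & (dist e X x0 (ys j) + dist e X (ys j) (xs j)
            + dist e (Ys j.-1) (xs j) p = dist e X x0 p :> \bar R)%E],
      Xs j = metric_ball (Ys j.-1)
        (cone_metric e (Ys j.-1 :|: Xs 0%N) (Ys j.-1) x0 (xs j)) (xs j)
        ((r j)%:E * (D%:R)%:E)%E
    & Ys j = Ys j.-1 :\: Xs j].
  move=> /andP[j1 jm]; have [j2|j2] := leqP 2 j.
    have [|_ jcut XsE YsE] := cones j; first by rewrite j2.
    by split=> //; exact: cone_cut_portal jcut.
  have -> : j = 1%N by apply/eqP; rewrite eqn_leq j1 -ltnS j2.
  split=> //; last by rewrite Ys0X.
  split=> //; last by exists z.
  by case/andP: r1P => r1l ->; rewrite andbT; lra.
have inv j : (j <= m)%N -> [/\ Ys j \subset X, pred_closed e X x0 (Ys j :|: Xs 0%N)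
    & forall t, (t \in Ys j) = (t \in X) && [forall i : 'I_j.+1, t \notin Xs i]].
  elim: j => [_|j IHj jm].
    split; first by rewrite Ys0 finset.subsetDl.
      by rewrite Ys0X => u' v' k' _ _ du' _; have [] := is_dist_mem du'.
    move=> t; rewrite Ys0 finset.in_setD andbC; congr (_ && _).
    by apply/idP/forallP => [tX0 i|/(_ ord0)//]; rewrite (ord1 i).
  have [YX Ycl YE] := IHj (ltnW jm).
  have [[/andP[rj0 _] xY _ _ _] XsE YsE] := step j.+1 jm.
  rewrite /= in xY XsE YsE.
  have [_ cl _ _] := cone_step D e_sym dP X0X YX x0X0 xY rj0 X0cl Ycl.
  rewrite -XsE -YsE in cl; split=> //.
    by rewrite YsE (fintype.subset_trans (finset.subsetDl _ _)).
  move=> t; rewrite YsE finset.in_setD YE andbCA; congr (_ && _).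
  apply/andP/forallP => [[tj /forallP tY] i|tY].
    have [ij|ij] := ltnP i j.+1; first exact: (tY (Ordinal ij)).
    by have -> : nat_of_ord i = j.+1 by apply/eqP; rewrite eqn_leq ij -ltnS ltn_ord.
  split; first exact: (tY ord_max).
  by apply/forallP => i; apply: (tY (widen_ord (leqnSn _) i)).
have XsY j : (1 <= j <= m)%N -> Xs j \subset Ys j.-1.
  by move=> /step[_ -> _]; apply/fintype.subsetP => t; rewrite inE => /andP[].
have disj i j t : (i < j)%N -> (j <= m)%N -> t \in Xs i -> t \in Xs j -> False.
  move=> ij jm ti tj; have jb : (1 <= j <= m)%N by rewrite jm (leq_trans _ ij).
  have := fintype.subsetP (XsY _ jb) _ tj.
  have [|_ _ ->] := inv j.-1; first exact: leq_trans (leq_pred j) jm.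
  have ij' : (i < j.-1.+1)%N by rewrite prednK// (leq_trans _ ij).
  by move=> /andP[_ /forallP /(_ (Ordinal ij'))]; rewrite /= ti.
split=> //.
- split=> // t tX0; have tX := fintype.subsetP X0X _ tX0; split; last by rewrite -X0P.
  exact: (is_dist_closed X0X x0X0 X0cl tX0 (dP _ tX)).
- move=> j jb; have [[/andP[rj0 rj2] xY yX0 eyx [p pY pE]] XsE _] := step j jb.
  have [|YX Ycl YE] := inv j.-1.
    by case/andP: jb => _; apply: leq_trans (leq_pred j).
  have [coneP _ xC _] := cone_step D e_sym dP X0X YX x0X0 xY rj0 X0cl Ycl.
  rewrite -XsE in coneP xC.
  have yX := fintype.subsetP X0X _ yX0.
  have [dx _] := portal_dist e_irr dP YX xY yX pY eyx pE.
  split=> //; first by apply: fintype.subset_trans (XsY j jb) YX.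
    split=> //; rewrite ltNge -X0P ?(fintype.subsetP YX)//.
    by have := xY; rewrite YE => /andP[_ /forallP /(_ ord0)].
  move=> t /coneP[k [dk _ kle]]; exists k => //; apply: le_trans kle _.
  by rewrite lerD2l ler_wpM2r.
- split=> [t tX|i j t im jm ti tj].
    have [_ _ YE] := inv m (leqnn m); have := YE t; rewrite Ysm finset.in_set0 tX /=.
    move/esym/negbT; rewrite negb_forall => /existsP[i]; rewrite negbK => ti.
    by exists i => //; rewrite -ltnS ltn_ord.
  by case: (ltngtP i j) => // ij; [case: (disj i j t) | case: (disj j i t)].
- move=> z1 z1X z1X0; have z1Y : z1 \in Ys 0%N by rewrite Ys0 finset.in_setD z1X0.
  have [[/andP[r10 _] _ _ _ _] XsE _] := step 1%N m1.
  have [YX Ycl _] := inv 0%N (leq0n m).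
  have [coneP _ _ memC] := cone_step D e_sym dP X0X YX x0X0 x1Y r10 X0cl Ycl.
  rewrite /= in XsE; rewrite -XsE in coneP memC.
  rewrite (z1z z1Y) in zE.
  have [dx [k dk dz]] :=
    portal_dist e_irr dP YX x1Y (fintype.subsetP X0X _ y1X) z1Y e1 (esym zE).
  have z1X1 := memC _ _ dk dz; split=> //.
  have [k' [dk' dk'' _]] := coneP _ z1X1; exists k' => //.
  by rewrite dz (is_dist_inj dk dk'').
Qed.

(** * Positions of vertices and portals in the queues *)

Lemma cluster_indexE (V : finType) (m : nat) (Xs : nat -> {set V}) (z : V) (j : nat) :
  (forall i, (i <= m)%N -> z \in Xs i -> i = j) -> (j <= m)%N -> z \in Xs j ->
  cluster_index m Xs z = j.
Proof.
move=> uniq_j jm zj; rewrite /cluster_index; set a := fun _ => _.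
have ha : has a (iota 0 m.+1) by apply/hasP; exists j => //; rewrite mem_iota.
have lt_a : (find a (iota 0 m.+1) < m.+1)%N by move: ha; rewrite has_find size_iota.
by have := nth_find 0%N ha; rewrite nth_iota//; apply: uniq_j.
Qed.

Lemma card_setI_seq (V : finType) (A : {set V}) (s : seq V) :
  uniq s -> #|A :&: [set z in s]| = count [in A] s.
Proof.
move=> us; rewrite -size_filter -(card_uniqP (filter_uniq _ us)).
by apply: eq_card => z; rewrite !inE mem_filter.
Qed.

Lemma sqrt_lt_nat (R : realType) (n N : nat) :
  (Num.sqrt (n%:R : R) < N%:R) = (n < N ^ 2)%N.
Proof.
rewrite -[in LHS](@ltr_pXn2r _ 2)// ?nnegrE ?sqrtr_ge0//.
by rewrite sqr_sqrtr// -natrX ltr_nat.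
Qed.

(** The portal enters the queue by time [i], and the first [i] entries of [Q] contribute at most [i]
    portals. *)
Lemma reg_queue_item (V : finType) (x0 : V) (m : nat) (Xs : nat -> {set V})
    (ys : nat -> V) (Q : seq V) (i : nat) :
  (1 <= i <= size Q)%N -> item x0 Q i \notin Xs 0%N ->
  exists k, [/\ (1 <= k <= size (reg_queue m Xs ys Q))%N, (k <= i)%N
    & item x0 (reg_queue m Xs ys Q) k = ys (cluster_index m Xs (item x0 Q i))].
Proof.
move=> ilt zX0; rewrite /reg_queue -(cat_take_drop i Q) filter_cat map_cat.
rewrite cat_take_drop.
set y := ys _; set s1 := map _ _; set s2 := map _ _.
have ys1 : y \in s1.
  apply: (map_f (fun z => ys (cluster_index m Xs z))); rewrite mem_filter zX0.
  by rewrite (take_item x0 ilt) mem_rcons mem_head.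
have [k [klt kle kE]] := item_queue_of x0 s2 ys1; exists k; split=> //.
apply: leq_trans kle (leq_trans (size_queue_of _) _).
rewrite size_map (leq_trans (size_subseq (filter_subseq _ _)))//.
by rewrite size_take_min geq_minl.
Qed.

(** The entry [i] itself triggers the insertion of the portal, if it is not already there. At that
    time the square of the queue length is at most [4 i] by [sqr_size_queue_of]. *)
Lemma fat_queue_item (R : realType) (V : finType) (x0 : V) (m : nat)
    (Xs : nat -> {set V}) (ys : nat -> V) (Q : seq V) (i : nat) :
  uniq Q -> (forall z, z \in Q -> exists2 j, (j <= m)%N & z \in Xs j) ->
  (forall i j z, (i <= m)%N -> (j <= m)%N -> z \in Xs i -> z \in Xs j -> i = j) ->
  (1 <= i <= size Q)%N ->
  let l := cluster_index m Xs (item x0 Q i) in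
  item x0 Q i \notin Xs 0%N ->
  (i < #|Xs l :&: [set z in take i Q]| ^ 2)%N ->
  let q := fat_queue R x0 m Xs ys Q in
  exists k, [/\ (1 <= k <= size q)%N, (k ^ 2 <= 4 * i)%N & item x0 q k = ys l].
Proof.
move=> uQ cover disj ilt l zX0 fati; rewrite /fat_queue /=.
set fat := fun n : nat => _ && _; pose g z := ys (cluster_index m Xs z).
have ciP z : z \in Q -> z \in Xs (cluster_index m Xs z) /\ (cluster_index m Xs z <= m)%N.
  move=> zQ; have [j jm zj] := cover z zQ.
  by rewrite (cluster_indexE _ jm zj)// => i' i'm zi'; apply: (disj _ _ z).
have sQ : size Q = (i + (size Q - i))%N by lia.
rewrite [in iota _ _]sQ iotaD filter_cat map_cat; set s1 := map _ _; set s2 := map _ _.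
have ls1 : ys l \in s1.
  apply: (map_f (fun n => ys (cluster_index m Xs (item x0 Q n)))).
  by rewrite mem_filter mem_iota /fat zX0 sqrt_lt_nat fati; lia.
have [k [klt kle kE]] := item_queue_of x0 s2 ls1; exists k; split=> //.
apply: leq_trans (_ : (size (queue_of s1) ^ 2 <= _)%N); first by rewrite leq_exp2r.
apply: (@sqr_size_queue_of _ _ x0 g fat); last by case/andP: ilt.
(* Clusters may share a portal, so the entries in the cluster of entry [n] are only a part of those
   with its portal; an inequality of counts is enough. *)
move=> n nlt /andP[_]; rewrite sqrt_lt_nat => /leq_trans; apply.
rewrite leq_exp2r// card_setI_seq ?take_uniq//; apply: sub_count => z /= zX.
have [nX nm] := ciP _ (mem_item x0 nlt).
rewrite /g (cluster_indexE _ nm zX)// => j jm zj.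
exact: (disj _ _ z).
Qed.

Lemma item_interleaving (V : finType) (x0 : V) (ball fat reg Q0 q : seq V) (k : nat) :
  interleaving x0 ball fat reg Q0 -> q \in [:: ball; fat; reg] ->
  (1 <= k <= size q)%N ->
  exists s, [/\ (1 <= s <= size Q0)%N, (s <= 3 * k)%N & item x0 Q0 s = item x0 q k].
Proof. by move=> il qin klt; apply: mem_take_item; apply: il qin _ klt. Qed.

Lemma cone_queue_ordering (V : finType) (X : {set V}) (x0 : V) (Q : seq V)
    (Xs : nat -> {set V}) (xs : nat -> V) (j : nat) :
  ordering Q (X :\ x0) -> Xs j \subset X -> x0 \notin Xs j ->
  ordering (cone_queue Xs xs Q j) (Xs j :\ xs j).
Proof.
move=> [uQ Qmem] /fintype.subsetP XjX x0j; split; first exact: filter_uniq.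
move=> z; rewrite mem_filter Qmem !finset.in_setD1.
case: (boolP (z \in Xs j)) => [zj|_]; last by rewrite !andbF.
have -> : z != x0 by apply: contraNneq x0j => <-.
by rewrite (XjX _ zj) !andbT.
Qed.

Lemma size_ordering (V : finType) (X : {set V}) (x0 : V) (Q : seq V) :
  x0 \in X -> ordering Q (X :\ x0) -> size Q = (#|X| - 1)%N.
Proof.
move=> x0X [uQ Qmem]; rewrite -(card_uniqP uQ) (eq_card Qmem).
by rewrite (cardsD1 x0 X) x0X add1n subn1.
Qed.

(** * Stretch of the output trees *)

(** In these estimates [q] is [r0 D], [g] is [eps D], [Dj] is the radius of the cone, and
    [a + 1 + b] is the walk through the ball, the portal edge and the cone. Here the ball part is at
    most [5 c q <= 5 D / 8], and [k < i] saves a full [D] in the cone. *)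
Lemma stretch_cone_lt (R : realType) (c i s k : nat) (D Dj q g a b : R) :
  c = (2 ^ 16)%N -> (i < c)%N -> (s <= 3 * i)%N -> (k < i)%N ->
  1000 <= D -> 0 <= q -> 8 * (c%:R * q) <= D -> g / 2 <= q -> Dj <= D + g / 2 - q ->
  a <= stretch c s * q -> b <= stretch c k * Dj ->
  a + 1 + b <= stretch c i * D.
Proof.
move=> hc ic si ki D1000 q0 qD gq DjD aP bP.
have ss : stretch c s <= 5 * c%:R :> R.
  exact: le_trans (le_stretch R hc si) (stretch3_lt R hc ic).
have : stretch c s * q <= 5 * c%:R * q by apply: ler_wpM2r.
have [iE kE] : stretch c i = i%:R :> R /\ stretch c k = k%:R :> R.
  by rewrite /stretch ic (ltn_trans ki ic).
rewrite iE; rewrite kE in bP.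
have : k%:R * Dj <= k%:R * D by apply: ler_wpM2l => //; lra.
have : (k%:R + 1) * D <= i%:R * D by apply: ler_wpM2r; [lra | rewrite natr1 ler_nat].
lra.
Qed.

(** The gain is [c q / 2 >= D / 32] in the ball; the losses are [D / 340] from the cone width and 1
    for the edge. *)
Lemma stretch_cone_fat (R : realType) (c i t s k : nat) (D Dj q g a b : R) :
  c = (2 ^ 16)%N -> (c <= i)%N -> (t ^ 2 <= 4 * i)%N -> (s <= 3 * t)%N -> (k <= i)%N ->
  1000 <= D -> 0 <= q -> D <= 16 * (c%:R * q) ->
  c%:R * loglog i * g <= D / 170 -> 0 <= Dj -> Dj <= D + g / 2 - q ->
  a <= stretch c s * q -> b <= stretch c k * Dj ->
  a + 1 + b <= stretch c i * D.
Proof.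
move=> hc ci ti st ki D1000 q0 qD gD Dj0 DjD aP bP; rewrite stretch_ge//.
have L4 := loglog_ge4 R hc ci.
have c0 : 0 <= c%:R :> R by [].
have CL : 0 <= c%:R * loglog i :> R by rewrite mulr_ge0//; lra.
have : stretch c s * q <= c%:R * (loglog i - 1 / 2) * q.
  by apply: ler_wpM2r => //; apply: stretch_fat ti st.
have : stretch c k * Dj <= c%:R * loglog i * Dj.
  by apply: ler_wpM2r => //; rewrite -stretch_ge//; apply: le_stretch.
have : c%:R * loglog i * Dj <= c%:R * loglog i * (D + g / 2 - q) by apply: ler_wpM2l.
lra.
Qed.

(** The cone part gains about [c D], against losses of at most [2 c q <= D / 4] in the ball,
    [D / 340] and 1. *)
Lemma stretch_cone_thin (R : realType) (c i s k : nat) (D Dj q g a b : R) :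
  c = (2 ^ 16)%N -> (c <= i)%N -> (s <= 3 * i)%N -> (k ^ 2 <= i)%N ->
  1000 <= D -> 0 <= q -> 8 * (c%:R * q) <= D -> 0 <= g ->
  c%:R * loglog i * g <= D / 170 -> 0 <= Dj -> Dj <= D + g / 2 - q ->
  a <= stretch c s * q -> b <= stretch c k * Dj ->
  a + 1 + b <= stretch c i * D.
Proof.
move=> hc ci si ki D1000 q0 qD g0 gD Dj0 DjD aP bP; rewrite stretch_ge//.
have L4 := loglog_ge4 R hc ci.
have c1 : 1024 <= c%:R :> R by rewrite ler_nat c_ge1024.
have CL : 0 <= c%:R * (loglog i - 1) :> R by rewrite mulr_ge0//; lra.
have : stretch c s * q <= c%:R * (loglog i + 1) * q.
  apply: ler_wpM2r => //; exact: le_trans (le_stretch R hc si) (stretch3_ge R hc ci).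
have : stretch c k * Dj <= c%:R * (loglog i - 1) * Dj.
  by apply: ler_wpM2r => //; apply: stretch_sqrt.
have : c%:R * (loglog i - 1) * Dj <= c%:R * (loglog i - 1) * (D + g / 2 - q).
  exact: ler_wpM2l.
have : 0 <= c%:R * g by rewrite mulr_ge0//; lra.
have : 1024 * D <= c%:R * D by apply: ler_wpM2r => //; lra.
lra.
Qed.

(** No position is gained, but [x_l] is reached at its exact distance [dx]. Write [dx + i Dj] as
    [(dx + Dj) + (i - 1) Dj]: the surplus [i g / 2] is absorbed by [(i - 1) q], as [i >= 2] and
    [g <= q]. *)
Lemma stretch_first_cone (R : realType) (c i k : nat) (D Dj q g dx b : R) :
  c = (2 ^ 16)%N -> (1 < i)%N -> (i < c)%N -> (k <= i)%N -> 0 <= q -> g <= q -> 0 <= Dj ->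
  q < dx -> dx + Dj <= D + g / 2 -> b <= stretch c k * Dj ->
  dx + b <= stretch c i * D.
Proof.
move=> hc i1 ic ki q0 gq Dj0 qdx dxD bP.
have : stretch c k * Dj <= stretch c i * Dj.
  by apply: ler_wpM2r => //; apply: le_stretch.
rewrite /stretch ic in bP *.
have i2 : 2 <= i%:R :> R by rewrite ler_nat.
have : (i%:R - 1) * Dj <= (i%:R - 1) * (D + g / 2 - q) by apply: ler_wpM2l; lra.
have : 0 <= (i%:R - 2) * (q - g / 2) by apply: mulr_ge0; lra.
lra.
Qed.

(** The ball is smaller than [X] by a factor of at least [8 c], far more than the tripling of the
    position costs. *)
Lemma stretch_ball (R : realType) (c i s : nat) (D q : R) :
  c = (2 ^ 16)%N -> (0 < i)%N -> (s <= 3 * i)%N -> 0 <= q -> 8 * (c%:R * q) <= D ->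
  stretch c s * q <= stretch c i * D.
Proof.
move=> hc i0 si q0 qD.
have c1 : 1024 <= c%:R :> R by rewrite ler_nat c_ge1024.
apply: (@le_trans _ _ (stretch c i * (8 * (c%:R * q)))); last first.
  by rewrite ler_wpM2l// stretch_ge0.
rewrite !mulrA; apply: ler_wpM2r => //; apply: le_trans (le_stretch R hc si) _.
have [ic|ci] := ltnP i c.
  apply: le_trans (stretch3_lt R hc ic) _; rewrite /stretch ic.
  have : 1 <= i%:R :> R by rewrite ler1n.
  nra.
apply: le_trans (stretch3_ge R hc ci) _; rewrite stretch_ge//.
have L4 := loglog_ge4 R hc ci.
have : loglog i * 1024 <= loglog i * c%:R :> R by apply: ler_wpM2l => //; lra.
move=> Lc; have : 0 <= c%:R * (8 * (loglog i * c%:R) - loglog i - 1) :> R.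
  by apply: mulr_ge0; lra.
lra.
Qed.

(** * Walks in the returned tree *)

Lemma item_default (T : Type) (x y : T) (s : seq T) (i : nat) :
  (1 <= i <= size s)%N -> item x s i = item y s i.
Proof. by case: i => // i ilt; apply: set_nth_default. Qed.

Lemma shortest_path_tree_walk (R : realType) (V : finType) (e : rel V) (X : {set V})
    (x0 z : V) (T : {set {set V}}) (n : nat) :
  shortest_path_tree R e X x0 T -> is_dist e X x0 z n ->
  exists2 p, walk (adj T) X x0 z p & (size p <= n)%N.
Proof.
move=> [_ Tdist] dz; have [_ zX] := is_dist_mem dz.
have : (dist (adj T) X x0 z <= (n%:R : R)%:E)%E by rewrite Tdist// (dist_is_dist R dz).
by case/dist_le_is_dist => _ [[p wp <-] _]; rewrite ler_nat; exists p.
Qed.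

Lemma star_tree_adj (V : finType) (m : nat) (Ts : nat -> {set {set V}})
    (xs ys : nat -> V) :
  let T := (\bigcup_(0 <= j < m.+1) Ts j)
           :|: \bigcup_(1 <= j < m.+1) [set [set ys j; xs j]] in
  (forall j, (j <= m)%N -> subrel (adj (Ts j)) (adj T)) /\
  (forall j, (1 <= j <= m)%N -> adj T (ys j) (xs j)).
Proof.
move=> T; split=> [j jm u v uv|[//|j] jm]; rewrite /adj /T finset.in_setU; apply/orP.
  by left; rewrite big_mkord; apply/finset.bigcupP; exists (Ordinal (jm : j < m.+1)%N).
right; rewrite big_add1 big_mkord; apply/finset.bigcupP.
by exists (Ordinal (jm : j < m)%N) => //; rewrite finset.in_set1.
Qed.

(** The exactness for [i = 1] is part of the induction: it gives exact tree distances to the first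
    portal within the central ball. *)
Lemma hierarchical_star_partition_walk (R : realType) (c : nat) (V : finType)
    (e : rel V) (X : {set V}) (x0 : V) (Q : seq V) (T : {set {set V}}) :
  c = (2 ^ 16)%N -> symmetric e -> irreflexive e ->
  hierarchical_star_partition e (c%:R : R)
    (fun Z : {set V} => 1 / (170 * c%:R * log2 (log2 #|Z|%:R))) X x0 Q T ->
  graph_connected e X -> x0 \in X -> ordering Q (X :\ x0) ->
  forall D, graph_rad e x0 X = (D%:R : R)%:E ->
  forall i, (1 <= i <= size Q)%N ->
  exists p, [/\ walk (adj T) X x0 (item x0 Q i) p,
    (size p)%:R <= stretch c i * D%:R :> R
    & i = 1%N -> forall n, is_dist e X x0 (item x0 Q i) n -> (size p <= n)%N].
Proof.
move=> hc e_sym e_irr; set eps := fun Z => _.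
have c1024 : 1024 <= c%:R :> R by rewrite ler_nat c_ge1024.
have stretch1 : stretch c 1 = 1 :> R by rewrite /stretch (leq_trans _ (c_ge1024 hc)).
have radX (X' : {set V}) x' D : x' \in X' -> graph_connected e X' ->
    graph_rad e x' X' = (D%:R : R)%:E ->
    (forall z n, is_dist e X' x' z n -> (n <= D)%N) /\ exists z, is_dist e X' x' z D.
  move=> x'X' X'c; have [D' [-> leD' exD']] := graph_radP R x'X' X'c.
  by move=> [/eqP]; rewrite eqr_nat => /eqP <-.
elim=> {X x0 Q T} [X x0 Q T _ Tspt|X x0 Q m Xs xs ys Qs Ts radlt sp _ IH]
  Xc x0X [Quniq Qmem] D radE i ilt; have [leD exD] := radX _ _ _ x0X Xc radE.
  have zX : item x0 Q i \in X.
    by have := mem_item x0 ilt; rewrite Qmem finset.in_setD1 => /andP[].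
  have [p0 /is_dist_exists[n dz]] := Xc _ _ x0X zX.
  have [p wp pn] := shortest_path_tree_walk Tspt dz; exists p; split=> //.
    apply: (@le_trans _ _ D%:R); first by rewrite ler_nat (leq_trans pn)// (leD _ _ dz).
    rewrite -[X in X <= _]mul1r ler_wpM2r// -stretch1 le_stretch//.
    by case/andP: ilt.
  by move=> _ n' dz'; rewrite (is_dist_inj dz' dz).
have D16 : 16 * c%:R < D%:R :> R by move: radlt; rewrite radE lte_fin.
have cX : (c <= #|X|)%N.
  case: exD => z /is_dist_lt_card; apply: leq_trans; rewrite leqW// -(ler_nat R); lra.
have L4 := loglog_ge4 R hc cX.
have cLE : c%:R * loglog #|X| * eps X = 1 / 170.
  rewrite /eps -/(loglog #|X|); field; rewrite !gt_eqF//; lra.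
have E0 : 0 < eps X.
  have cL0 : 0 < c%:R * loglog #|X| :> R by apply: mulr_gt0; lra.
  by rewrite -(pmulr_rgt0 _ cL0) cLE divr_gt0.
(* From here on [eps] is known only through [cLE] and its positivity. *)
clearbody eps.
have cE : c%:R * eps X <= 1 / 680.
  have : c%:R * eps X * 4 <= c%:R * eps X * loglog #|X|.
    by apply: ler_wpM2l => //; rewrite mulr_ge0//; lra.
  lra.
have c0 : 0 < c%:R :> R by lra.
have [d [r0 [[dP /andP[r0l r0u]] [X0X x0X0 X0d] cone [cover disj] first]]] :=
  star_partitionP e_sym e_irr Xc x0X radE c0 E0 sp.
case: sp => r [Ys [[_ xs0 _ _] _ [m1 _ _] QsE [Q0ord Q0head Q0il]]] {r Ys radlt}.
pose q := r0 * D%:R; pose g := eps X * D%:R.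
have D1000 : 1000 <= D%:R :> R by lra.
have r0c : 1 / 16 <= c%:R * r0 <= 1 / 8.
  move: r0l r0u; rewrite ler_pdivrMr ?ler_pdivlMr ?mulr_gt0// => r0l r0u.
  by apply/andP; split; lra.
have [r0c1 r0c2] := andP r0c.
have r00 : 0 <= r0 by move: r0l; apply: le_trans; rewrite divr_ge0// mulr_ge0// ltW.
have q0 : 0 <= q by rewrite mulr_ge0.
have g0 : 0 <= g by rewrite mulr_ge0// ltW.
have q8 : 8 * (c%:R * q) <= D%:R.
  have : c%:R * r0 * D%:R <= 1 / 8 * D%:R := ler_wpM2r (ler0n _ _) r0c2.
  by rewrite /q; lra.
have q16 : D%:R <= 16 * (c%:R * q).
  have : 1 / 16 * D%:R <= c%:R * r0 * D%:R := ler_wpM2r (ler0n _ _) r0c1.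
  by rewrite /q; lra.
have gq : g <= q.
  by rewrite ler_wpM2r// -(ler_pM2l c0); lra.
(* The factor [log log |Z|] in the denominator of [eps] is used here: as [i <= |X|], it cancels the
   [loglog i] of the bound. *)
have gi : (c <= i)%N -> (i <= #|X|)%N -> c%:R * loglog i * g <= D%:R / 170.
  move=> ci iX; have := le_loglog R hc ci iX; have := loglog_ge4 R hc ci => ? ?.
  rewrite /g mulrA mulrC ler_wpM2l// -[leRHS]mul1r -cLE.
  by rewrite ler_wpM2r ?ler_wpM2l// ltW.
have iX : (i <= #|X|)%N.
  by case/andP: ilt => _ /leq_trans; apply; rewrite (size_ordering x0X)// leq_subr.
set T := _ :|: _; have [adjT edgeT] := star_tree_adj m Ts xs ys.
rewrite -/T in adjT edgeT.
set z := item x0 Q i.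
have zX : z \in X by have := mem_item x0 ilt; rewrite Qmem finset.in_setD1 => /andP[].
have [i0 iQ] := andP ilt.
have x0j j : (1 <= j <= m)%N -> x0 \notin Xs j.
  move=> /andP[j1 jm]; apply/negP => /(disj _ _ _ (leq0n m) jm x0X0) j0.
  by rewrite -j0 in j1.
have z1X0 : i = 1%N -> item x0 Q 1 = z by move=> i1; rewrite /z i1.
have X0c : graph_connected e (Xs 0%N).
  by apply: (is_dist_connected (x := x0)) => // t /X0d[dt _]; exists (d t).
have [D0 [rad0 _ [y0 dy0]]] := graph_radP R x0X0 X0c.
have D0q : D0%:R <= q.
  have [_ y0X0] := is_dist_mem dy0; have [dy0' y0q] := X0d _ y0X0.
  by rewrite (is_dist_inj dy0 dy0').
have walk0 s : (1 <= s <= size (Qs 0%N))%N ->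
  exists p, [/\ walk (adj (Ts 0%N)) (Xs 0%N) x0 (item x0 (Qs 0%N) s) p,
    (size p)%:R <= stretch c s * q :> R
    & s = 1%N -> (size p <= d (item x0 (Qs 0%N) s))%N].
  move=> slt; have := IH 0%N (leq0n m); rewrite xs0 => IH0.
  have [p [wp sizep p1]] := IH0 X0c x0X0 Q0ord D0 rad0 s slt; exists p; split=> //.
    by apply: le_trans sizep _; rewrite ler_wpM2l// stretch_ge0.
  move=> s1; apply: p1 => //; have [_ yX0] := walk_mem wp.
  by have [] := X0d _ yX0.
have first0 : (1 <= 1 <= size (Qs 0%N))%N /\ item x0 (Qs 0%N) 1 =
    if item x0 Q 1 \in Xs 0%N then item x0 Q 1 else ys 1%N.
  by move: Q0head; case: (Qs 0%N) => //= a l [->].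
have [l lm zl] := cover z zX.
have ciE : cluster_index m Xs z = l.
  by apply: cluster_indexE => // j jm zj; apply: (disj _ _ z).
case: (posnP l) => [l0|l0].
  have zX0 : z \in Xs 0%N by rewrite -l0.
  (* For [i = 1] the vertex heads the ordering of the ball; otherwise its position comes from the
     ball queue. *)
  have [s [slt s3 sz s1]] : exists s, [/\ (1 <= s <= size (Qs 0%N))%N, (s <= 3 * i)%N,
      item x0 (Qs 0%N) s = z & i = 1%N -> s = 1%N].
    have [i1|i1] := eqVneq i 1%N.
      have [? E] := first0; exists 1%N; split=> //; first by rewrite i1.
      by rewrite E (z1X0 i1) zX0.
    have [klt ki kE] := item_filter (p := fun t => t \in Xs 0%N) ilt zX0.
    have [|s [slt s3 sE]] := item_interleaving Q0il _ klt; first by rewrite mem_head.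
    exists s; split=> //; last by move/eqP: i1.
      by apply: leq_trans s3 _; rewrite leq_mul2l ki.
    by rewrite sE kE.
  have [p [wp sizep p1]] := walk0 s slt; rewrite sz in wp p1; exists p; split.
  - exact: walk_mono (adjT _ _) X0X wp.
  - exact: le_trans sizep (stretch_ball hc i0 s3 q0 q8).
  - by move=> i1 n dz; rewrite (is_dist_inj dz (dP _ zX)) p1 ?s1.
have lb : (1 <= l <= m)%N by rewrite l0.
have zX0 : z \notin Xs 0%N.
  by apply/negP => zX0; move: l0; rewrite -(disj _ _ _ (leq0n m) lm zX0 zl).
have [XlX xlXl [yX0 eyx] [dxE dxq] coneP] := cone l lb.
have Xlc : graph_connected e (Xs l).
  by apply: (is_dist_connected (x := xs l)) => // t /coneP[k dk _]; exists k.
have [Dl [radl _ [yl dyl]]] := graph_radP R xlXl Xlc.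
have dxD : (d (xs l))%:R + Dl%:R <= D%:R + g / 2.
  have [_ ylXl] := is_dist_mem dyl; have [k dk kle] := coneP _ ylXl.
  rewrite (is_dist_inj dyl dk); apply: le_trans kle _.
  have : (d yl)%:R <= D%:R :> R.
    by rewrite ler_nat (leD _ _ (dP _ (fintype.subsetP XlX _ ylXl))).
  by rewrite /g; lra.
have DlD : Dl%:R <= D%:R + g / 2 - q by rewrite -/q in dxq; lra.
(* When [z] is not the root [xs l], this is its position in the queue of the cone; the root itself
   is reached by the empty walk. *)
pose k := count (fun t => (t \in Xs l) && (t != xs l)) (take i Q).
have ki : (k <= i)%N.
  by apply: leq_trans (count_size _ _) _; rewrite size_take_min geq_minl.
have [pl [wl sizel pl1]] : exists pl, [/\ walk (adj (Ts l)) (Xs l) (xs l) z pl,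
    (size pl)%:R <= stretch c k * Dl%:R :> R
    & i = 1%N -> forall n, is_dist e (Xs l) (xs l) z n -> (size pl <= n)%N].
  have [zE|zN] := eqVneq z (xs l).
    exists [::]; split=> //; last by rewrite mulr_ge0// stretch_ge0.
    by rewrite zE /walk /= eqxx xlXl.
  have [|klt _ kE] :=
      item_filter (x0 := x0) (p := fun t => (t \in Xs l) && (t != xs l)) ilt.
    by rewrite -/z zl zN.
  have Qlord : ordering (Qs l) (Xs l :\ xs l).
    rewrite QsE//; apply: cone_queue_ordering (conj Quniq Qmem) XlX _; exact: x0j.
  have [|pl []] := IH l lm Xlc xlXl Qlord Dl radl k; first by rewrite QsE.
  (* The induction hypothesis reads the queue with default [xs l]; the position is in range, so the
     default can be changed to [x0]. *)
  rewrite (item_default _ x0) QsE// kE => wl sizel pl1; exists pl; split=> //.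
  by move=> i1; apply: pl1; move: klt ki; rewrite -/k i1; case: (k) => [|[]].
have glue p0 : walk (adj (Ts 0%N)) (Xs 0%N) x0 (ys l) p0 ->
    walk (adj T) X x0 z (p0 ++ xs l :: pl).
  move=> w0; apply: (walk_cat (y := ys l)); first exact: walk_mono (adjT _ _) X0X w0.
  apply: (walk_cat (y := xs l) (p := [:: xs l])); last exact: walk_mono (adjT _ _) XlX wl.
  apply: walk1; [exact: (fintype.subsetP X0X)|exact: (fintype.subsetP XlX)|exact: edgeT].
have size_glue p0 : (size (p0 ++ xs l :: pl))%:R = (size p0)%:R + 1 + (size pl)%:R :> R.
  by rewrite size_cat /= natr1 -natrD addSnnS.
(* A cluster containing [z_1] is the first cone, whose portal [ys 1] comes first in
   the ordering of the central ball. *)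
have portal1 : item x0 Q 1 \in Xs l -> exists2 p0,
    walk (adj (Ts 0%N)) (Xs 0%N) x0 (ys l) p0 & (size p0 <= d (ys l))%N.
  move=> z1l; have z1X : item x0 Q 1 \in X := fintype.subsetP XlX _ z1l.
  have z1N : item x0 Q 1 \notin Xs 0%N.
    by apply/negP => z1X0'; move: l0; rewrite -(disj _ _ _ (leq0n m) lm z1X0' z1l).
  have [z11 _] := first z1X z1N.
  have -> : l = 1%N by apply: (disj _ _ _ lm m1 z1l z11).
  have [slt E] := first0; rewrite (negPf z1N) in E.
  by have [p0 [w0 _ /(_ erefl) p01]] := walk0 1%N slt; rewrite E in w0 p01; exists p0.
(* The bound is asked for every admissible [a], since the length of the walk to the portal is known
   only through the induction hypothesis. *)
have far s : (1 <= s <= size (Qs 0%N))%N -> item x0 (Qs 0%N) s = ys l -> i != 1%N ->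
    (forall a : R, a <= stretch c s * q ->
       a + 1 + (size pl)%:R <= stretch c i * D%:R) ->
    exists p, [/\ walk (adj T) X x0 z p, (size p)%:R <= stretch c i * D%:R :> R
      & i = 1%N -> forall n, is_dist e X x0 z n -> (size p <= n)%N].
  move=> slt sE i1 bnd; have [p0 [w0 size0 _]] := walk0 s slt; rewrite sE in w0.
  exists (p0 ++ xs l :: pl); split; [exact: glue | | by move/eqP: i1].
  by rewrite size_glue; apply: bnd.
have [i1|i1] := eqVneq i 1%N.
  have z1E := z1X0 i1; have [|p0 w0 size0] := portal1; first by rewrite z1E.
  exists (p0 ++ xs l :: pl).
  have sized : (size (p0 ++ xs l :: pl) <= d z)%N.
    have := first; rewrite /= z1E => /(_ zX zX0)[z11 [n dn dzE]].
    have l1 : l = 1%N by apply: (disj _ _ _ lm m1 zl z11).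
    rewrite -l1 in dn dzE; have := pl1 i1 n dn.
    rewrite size_cat /= dzE dxE addnS addSn ltnS => ?; exact: leq_add.
  split; first exact: glue.
    rewrite i1 stretch1 mul1r ler_nat; apply: leq_trans sized _.
    exact: leD (dP _ zX).
  by move=> _ n dz; rewrite (is_dist_inj dz (dP _ zX)).
have [kr [krlt kri krE]] := reg_queue_item m ys ilt zX0.
have [|s [slt s3 sE]] := item_interleaving Q0il _ krlt; first by rewrite !inE eqxx !orbT.
rewrite krE -/z ciE in sE.
have {s3} si : (s <= 3 * i)%N by apply: leq_trans s3 _; rewrite leq_mul2l kri.
have i2 : (1 < i)%N by rewrite ltn_neqAle eq_sym i1.
have [ic|ci] := ltnP i c.
  have [ki'|ki'] := ltnP k i.
    apply: (far s) => // a aP.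
    by apply: stretch_cone_lt hc ic si ki' _ _ _ _ DlD aP sizel => //; lra.
  (* Now [k = i]: all of the first [i] entries lie in this cone, so it contains the first entry and
     is the first cone. *)
  have z1l : item x0 Q 1 \in Xs l.
    have allk : all (fun t => (t \in Xs l) && (t != xs l)) (take i Q).
      rewrite all_count -/k size_takel//; apply/eqP/anti_leq; rewrite ki.
      by rewrite ki'.
    have z1i : item x0 Q 1 \in take i Q.
      by rewrite /item -(nth_take x0 (i0 : 0 < i)%N) mem_nth// size_takel.
    by have /andP[] := allP allk _ z1i.
  have [p0 w0 size0] := portal1 z1l; exists (p0 ++ xs l :: pl).
  split; [exact: glue | | by move/eqP: i1].
  rewrite size_glue.
  apply: le_trans (stretch_first_cone hc i2 ic ki q0 gq _ dxq dxD sizel) => //.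
  by rewrite lerD2r dxE -natr1 lerD2r ler_nat.
have {}gi := gi ci iX.
have kN : (k <= #|Xs l :&: [set t in take i Q]|)%N.
  rewrite card_setI_seq ?take_uniq//; apply: sub_count => t /= /andP[]//.
(* In the fat case the portal is found early in the fat queue; in the thin case [k ^ 2 <= i] by
   [kN], and the regular queue is good enough. *)
have [fat|thin] := ltnP i (#|Xs l :&: [set t in take i Q]| ^ 2).
  have [||t [tlt ti tE]] := fat_queue_item R ys Quniq _ disj ilt zX0.
  - by move=> t; rewrite Qmem finset.in_setD1 => /andP[_ /cover].
  - by rewrite -/z ciE.
  have [|s' [slt' s3' sE']] := item_interleaving Q0il _ tlt.
    by rewrite !inE eqxx !orbT.
  rewrite tE -/z ciE in sE'.
  apply: (far s') => // a aP.
  exact: stretch_cone_fat hc ci ti s3' ki D1000 q0 q16 gi _ DlD aP sizel.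
apply: (far s) => // a aP.
apply: stretch_cone_thin hc ci si _ D1000 q0 q8 g0 gi _ DlD aP sizel => //.
by apply: leq_trans thin; rewrite leq_exp2r.
Qed.

Theorem lemma4 (R : realType) (c : nat) (hc : c = (2 ^ 16)%N)
    (V : finType) (e : rel V) (e_sym : symmetric e) (e_irr : irreflexive e)
    (X : {set V}) (x0 : V) (Q : seq V) (T : {set {set V}})
    (X_conn : graph_connected e X) (x0X : x0 \in X)
    (Q_ord : ordering Q (X :\ x0))
    (T_out : hierarchical_star_partition e (c%:R : R)
       (fun Z : {set V} => 1 / (170 * c%:R * log2 (log2 #|Z|%:R)))
       X x0 Q T) :
  forall i : nat, (1 <= i <= #|X| - 1)%N ->
    (dist (adj T) X x0 (item x0 Q i) <=
       if (i == 1)%N then dist e X x0 (item x0 Q i)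
       else if (i < c)%N then (i%:R : R)%:E * graph_rad e x0 X
       else (c%:R * log2 (log2 (i%:R : R)))%:E * graph_rad e x0 X)%E.
Proof.
move=> i ilt; have ilt' : (1 <= i <= size Q)%N by rewrite (size_ordering x0X).
have [D [radE leD _]] := graph_radP R x0X X_conn.
have [p [wp sizep p1]] :=
  hierarchical_star_partition_walk hc e_sym e_irr T_out X_conn x0X Q_ord radE ilt'.
have distp : (dist (adj T) X x0 (item x0 Q i) <= ((size p)%:R : R)%:E)%E.
  by apply: ereal_inf_lbound; exists p.
apply: le_trans distp _; case: eqP => [i1|_].
  have zX : item x0 Q i \in X.
    by have := mem_item x0 ilt'; case: Q_ord => _ ->; rewrite finset.in_setD1 => /andP[].
  have [p' /is_dist_exists[n dz]] := X_conn _ _ x0X zX.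
  by rewrite (dist_is_dist R dz) lee_fin ler_nat p1.
by move: sizep; rewrite radE /stretch; case: ifP => _; rewrite -EFinM lee_fin.
Qed.
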